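(* Let $\mathcal G$ be a compact, connected metric graph with vertex set $V$, edge set $E$ and edge lengths $(\ell_e)_{e\in E}$, let $\mathcal A=\mathcal A(q,\mathcal B,w,V_0)$ be a Schrödinger operator on $\mathcal G$ as described in the context (in particular $0\le q\in L^1(\mathcal G)$, $\mathcal B$ is Hermitian and generates a positive semigroup $(e^{-t\mathcal B})_{t\ge 0}$), and let $(\psi_n)_{n\in\mathbb N}$ be an arbitrary orthonormal basis of $L^2(\mathcal G)$ consisting of real eigenfunctions of $\mathcal A$, ordered according to the eigenvalues $\lambda_1\le\lambda_2\le\dots$. Let $\nu_n$ be the number of nodal domains of $\psi_n$. Then $$\operatorname{acc}\left\{\tfrac{\nu_n}{n}:n\in\mathbb N\right\}\subset\left\{\frac{\sum_{e\in E_0}\ell_e}{|\mathcal G|}: E_0\subset E\text{ is a nonempty set of edges}\right\}.$$ In particular, $\operatorname{acc}\{\tfrac{\nu_n}{n}:n\in\mathbb N\}$ is a finite set, and $$0<\frac{\ell_{\min}}{|\mathcal G|}\le\liminf_{n\to\infty}\frac{\nu_n}{n}\le\limsup_{n\to\infty}\frac{\nu_n}{n}\le 1,$$ where $\ell_{\min}:=\min_{e\in E}\ell_e$.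
   Context: Metric graph: $\mathcal G$ is obtained from a finite connected combinatorial graph $(V,E)$ (loops and multiple edges allowed) by identifying each edge $e\in E$ with an interval $[0,\ell_e]$ of finite length $\ell_e>0$ and gluing endpoints at the vertices; it carries the path metric and the Lebesgue measure $|\cdot|$, and $|\mathcal G|=\sum_{e\in E}\ell_e$. For $v\in V$, $\deg(v)$ is the number of edge ends at $v$ (a loop counts twice), and for an edgewise $H^1$ function $f$, $f(v)=(f_e(v))_e\in\mathbb C^{\deg(v)}$ is the vector of boundary values of $f$ at the edge ends at $v$. Operator: fix a (possibly empty) set $V_0\subset V$; a potential $0\le q\in L^1(\mathcal G)$; a Hermitian $2|E|\times 2|E|$ matrix $\mathcal B$, with blocks $\mathcal B_{vw}$ of size $\deg(v)\times\deg(w)$ for $v,w\in V$, such that the semigroup $(e^{-t\mathcal B})_{t\ge0}$ is positive (equivalently, all entries of $\mathcal B$ are real and all off-diagonal entries are $\le0$); and weight vectors $w_v=(w_{e,v})_e\in(0,\infty)^{\deg(v)}$, $v\in V\setminus V_0$. Let $H^1_{0,w}(\mathcal G;V_0)$ be the space of edgewise $H^1$ functions $f$ on $\mathcal G$ such that $w_{e,v}f_e(v)=w_{e',v}f_{e'}(v)$ for all edge ends $e,e'$ at each $v\in V\setminus V_0$, and $f(v)=0$ for each $v\in V_0$. The operator $\mathcal A(q,\mathcal B,w,V_0)$ is the self-adjoint operator on $L^2(\mathcal G)$ associated with the closed quadratic form $$a(f)=\int_{\mathcal G}\left(|f'(x)|^2+q(x)|f(x)|^2\right)dx+\sum_{v,w\in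 V}\left(\mathcal B_{vw}f(w),f(v)\right)_{\mathbb C^{\deg(v)}},\qquad D(a)=H^1_{0,w}(\mathcal G;V_0).$$ Its spectrum consists of real eigenvalues $\lambda_1\le\lambda_2\le\dots\to+\infty$, repeated according to their finite multiplicities. Nodal domains of $\psi_n$: the closures in $\mathcal G$ of the connected components of $\{\psi_n\ne0\}$. (At each vertex the boundary values of $\psi_n$ along the incident edge ends are either all zero or all nonzero of the same sign, so this set is well defined.) For a sequence $(a_n)\subset\mathbb R$, $\operatorname{acc}\{a_n:n\in\mathbb N\}$ is the set of its points of accumulation, i.e. of limits of its convergent subsequences. *)

(* Defs.v *)
From HB Require Import structures.
From mathcomp Require Import all_boot all_order all_algebra.
From mathcomp Require Import all_classical all_reals all_analysis.
From mathcomp Require Import finmap complex.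

Set Implicit Arguments.
Unset Strict Implicit.
Unset Printing Implicit Defensive.

Import Order.TTheory GRing.Theory Num.Theory numFieldNormedType.Exports.

Local Open Scope classical_set_scope.
Local Open Scope ring_scope.
Local Open Scope quotient_scope.

(* The edge end (e, false) is the point 0 of the interval [0, len e], and
   (e, true) is the point len e.  Loops and multiple edges are allowed; a loop
   contributes both of its ends to its vertex. *)
Record metric_graph (R : realType) := MetricGraph {
  vert : finType;
  edge : finType;
  vert_of : edge * bool -> vert;
  len : edge -> R;
  len_gt0 : forall e, 0 < len e;
  graph_connected : forall u v : vert,
    connect [rel x y | [exists e, [exists b,
      (vert_of (e, b) == x) && (vert_of (e, ~~ b) == y)]]] u v }.

Definition edge_end (R : realType) (G : metric_graph R) : finType :=
  (edge G * bool)%type.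

Definition end_coord (R : realType) (G : metric_graph R)
    (i : edge_end G) : R := if i.2 then len i.1 else 0.

Definition total_len (R : realType) (G : metric_graph R) : R :=
  \sum_(e : edge G) len e.

(* The default value of the minimum is harmless, since len e <= total_len G. *)
Definition min_len (R : realType) (G : metric_graph R) : R :=
  \big[Order.min/total_len G]_(e : edge G) len e.

(* The underlying space of the graph: the quotient of the disjoint union of
   the intervals [0, len e] that identifies the end points lying at a same
   vertex.  The quotient topology is the one induced by the path metric. *)
Definition edge_point (R : realType) (G : metric_graph R) :=
  {e : edge G & set_type (`[0, len e] : set R)}.

Definition edge_point_loc (R : realType) (G : metric_graph R)
    (p : edge_point G) : vert G + edge G * R :=
  let e := tag p in let x := \val (tagged p) in
  if x == 0 then inl (vert_of (e, false))
  else if x == len e then inl (vert_of (e, true))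
  else inr (e, x).

Definition glue (R : realType) (G : metric_graph R) : rel (edge_point G) :=
  fun p p' => edge_point_loc p == edge_point_loc p'.
Arguments glue {R} G.

Lemma glue_refl (R : realType) (G : metric_graph R) : reflexive (glue G).
Proof. by move=> p; rewrite /glue. Qed.

Lemma glue_sym (R : realType) (G : metric_graph R) : symmetric (glue G).
Proof. by move=> p p'; rewrite /glue eq_sym. Qed.

Lemma glue_trans (R : realType) (G : metric_graph R) : transitive (glue G).
Proof. by move=> p p' p''; rewrite /glue => /eqP -> /eqP ->. Qed.

Canonical glue_equiv (R : realType) (G : metric_graph R) :=
  EquivRel (glue G) (@glue_refl R G) (@glue_sym R G) (@glue_trans R G).

Definition graph_space (R : realType) (G : metric_graph R) :=
  quotient_topology {eq_quot (glue_equiv G)}.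

(* Functions on the graph are given edgewise; only the values on [0, len e]
   are relevant. *)
Definition gfun (R : realType) (G : metric_graph R) := edge G -> R -> R[i].

Definition gfun_of_real (R : realType) (G : metric_graph R)
  (f : edge G -> R -> R) : gfun G := fun e x => (f e x)%:C%C.

Definition cintegral (R : realType) (l : R) (f : R -> R[i]) : R[i] :=
  ((\int[lebesgue_measure]_(x in `[0, l]) complex.Re (f x))
   +i* (\int[lebesgue_measure]_(x in `[0, l]) complex.Im (f x)))%C.

Definition csqnorm (R : realType) (z : R[i]) : R :=
  complex.Re z ^+ 2 + complex.Im z ^+ 2.

Definition in_L2 (R : realType) (l : R) (f : R -> R[i]) : Prop :=
  [/\ measurable_fun `[0, l] (fun x => complex.Re (f x)),
      measurable_fun `[0, l] (fun x => complex.Im (f x)) &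
      (@lebesgue_measure R).-integrable `[0, l]
        (fun x => (csqnorm (f x))%:E)].

Definition is_weak_deriv (R : realType) (l : R) (f g : R -> R[i]) : Prop :=
  in_L2 l g /\ forall x, 0 <= x <= l -> f x = f 0 + cintegral x g.

(* H^1 functions are represented by their continuous representative. *)
Definition in_H1 (R : realType) (l : R) (f : R -> R[i]) : Prop :=
  exists g, is_weak_deriv l f g.

(* Some representative of the weak derivative, which is unique a.e. *)
Definition weak_deriv (R : realType) (l : R) (f : R -> R[i]) : R -> R[i] :=
  xget (fun=> 0) [set g | is_weak_deriv l f g].

Definition in_L2G (R : realType) (G : metric_graph R) (f : gfun G) : Prop :=
  forall e, in_L2 (len e) (f e).

Definition L2G_dot (R : realType) (G : metric_graph R) (f g : gfun G) : R[i] :=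
  \sum_(e : edge G) cintegral (len e) (fun x => f e x * (g e x)^*).

Definition L2G_sqnorm (R : realType) (G : metric_graph R) (f : gfun G) : R :=
  \sum_(e : edge G)
    \int[lebesgue_measure]_(x in `[0, len e]) csqnorm (f e x).

Definition mx_exp (R : realType) n (A : 'M[R[i]]_n) : 'M[R[i]]_n :=
  lim ((fun N => \sum_(k < N) (k`!%:R)^-1 *: A ^+ k : 'M[R[i]^o]_n) @ \oo).

(* The order on R[i] is the one for which 0 <= z means that z is real and
   nonnegative. *)
Definition generates_positive_semigroup (R : realType) n (B : 'M[R[i]]_n) :
    Prop :=
  forall (t : R) (x : 'cV[R[i]]_n), 0 <= t -> (forall i, 0 <= x i 0) ->
    forall i, 0 <= (mx_exp (- (t%:C%C *: B)) *m x) i 0.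

Definition end_value (R : realType) (G : metric_graph R) (f : gfun G)
  (i : edge_end G) : R[i] := f i.1 (end_coord i).

Definition in_form_dom (R : realType) (G : metric_graph R)
    (w : edge_end G -> R) (V0 : {set vert G}) (f : gfun G) : Prop :=
  [/\ forall e, in_H1 (len e) (f e),
      forall i j : edge_end G, vert_of i = vert_of j -> vert_of i \notin V0 ->
        (w i)%:C%C * end_value f i = (w j)%:C%C * end_value f j &
      forall i : edge_end G, vert_of i \in V0 -> end_value f i = 0].

(* The rows and columns of B are indexed by the edge ends.  The block B_vw
   couples the ends at v with the ends at w; as every end lies at exactly one
   vertex, the sum over all pairs of blocks is a sum over all pairs of ends. *)
Definition schrodinger_form (R : realType) (G : metric_graph R) (q : edge G -> R -> R)
    (B : 'M[R[i]]_#|edge_end G|) (f g : gfun G) : R[i] :=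
  \sum_(e : edge G) cintegral (len e) (fun x =>
      weak_deriv (len e) (f e) x * (weak_deriv (len e) (g e) x)^*
      + (q e x)%:C%C * f e x * (g e x)^*)
  + \sum_(i : edge_end G) \sum_(j : edge_end G)
      B (enum_rank i) (enum_rank j) * end_value f j * (end_value g i)^*.

(* The graph of the self-adjoint operator associated with the form: f lies in
   its domain and is mapped to g. *)
Definition schrodinger_op (R : realType) (G : metric_graph R)
    (q : edge G -> R -> R) (B : 'M[R[i]]_#|edge_end G|)
    (w : edge_end G -> R) (V0 : {set vert G}) (f g : gfun G) : Prop :=
  [/\ in_form_dom w V0 f, in_L2G g &
      forall h, in_form_dom w V0 h -> schrodinger_form q B f h = L2G_dot g h].

Definition orthonormal_basis (R : realType) (G : metric_graph R)
    (psi : nat -> gfun G) : Prop :=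
  [/\ forall n, in_L2G (psi n),
      forall m n, L2G_dot (psi m) (psi n) = (m == n)%:R &
      forall f, in_L2G f ->
        L2G_sqnorm (fun e x =>
          f e x - \sum_(k < N) L2G_dot f (psi k) * psi k e x)
        @[N --> \oo] --> 0].

(* The sequences start at 0 : lam n is the eigenvalue number n + 1, counted
   with multiplicity. *)
Definition eigenbasis (R : realType) (G : metric_graph R)
    (q : edge G -> R -> R) (B : 'M[R[i]]_#|edge_end G|)
    (w : edge_end G -> R) (V0 : {set vert G})
    (lam : nat -> R) (psi : nat -> edge G -> R -> R) : Prop :=
  [/\ orthonormal_basis (fun n => gfun_of_real (psi n)),
      forall n, schrodinger_op q B w V0 (gfun_of_real (psi n))
        (fun e x => (lam n)%:C%C * gfun_of_real (psi n) e x) &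
      {homo lam : m n / (m <= n)%N >-> m <= n}].

(* For psi in the domain of the form the boundary values at a vertex are all
   zero or all nonzero, so the choice of a representative is immaterial. *)
Definition nonzero_set (R : realType) (G : metric_graph R)
    (psi : edge G -> R -> R) : set (graph_space G) :=
  (\pi_(graph_space G) : edge_point G -> graph_space G) @`
    [set p : edge_point G | psi (tag p) (\val (tagged p)) != 0].

Definition nodal_domains (R : realType) (G : metric_graph R)
    (psi : edge G -> R -> R) : set (set (graph_space G)) :=
  [set closure (connected_component (nonzero_set psi) x)
     | x in nonzero_set psi].

Definition nodal_count (R : realType) (G : metric_graph R)
    (psi : edge G -> R -> R) : nat := #|` fset_set (nodal_domains psi)|.

Definition nodal_ratio (R : realType) (G : metric_graph R)
    (psi : nat -> edge G -> R -> R) (n : nat) : R :=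
  (nodal_count (psi n))%:R / n.+1%:R.

Definition acc (R : realType) (a : nat -> R) : set R :=
  [set l | exists phi : nat -> nat,
     {homo phi : m n / (m < n)%N} /\ a (phi n) @[n --> \oo] --> l].

(* Main.v *)
Require Import Defs.
From HB Require Import structures.
From mathcomp Require Import all_boot all_order all_algebra.
From mathcomp Require Import all_classical all_reals all_analysis.
From mathcomp Require Import measurable_realfun finmap complex.
From mathcomp Require Import lra ring.

(** Let f be an eigenfunction for the eigenvalue lam = m^2, with m large, and
let l be the length of an edge on which f does not vanish identically.  By
variation of constants f is uniformly close on that edge to A sin(m x + ph),
and f' / m to A cos(m x + ph), so that f has m l / pi + O(1) zeros there.  The
nodal domains are counted, up to O(1), by these zeros: hence
nu_n = sqrt(lam_n) / pi * (sum of the lengths of the edges on which psi_n is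
not identically zero) + O(1).

It remains to prove Weyl's law sqrt(lam_n) = pi n / |G| + O(1).  The form
differs from the energy by C (d * energy + (1 / d + D) * L2 norm) for every
d > 0, so that min-max reduces the matter to the energy.  For the upper bound
the test functions are the half-periods of sin(k x), which have disjoint
supports and for which the energy is k^2 times the L2 norm.  For the lower
bound each edge is cut into intervals of length less than pi / k, at the
midpoints of which one requires the functions to vanish: the energy is then at
least k^2 times the L2 norm.  Both families have k |G| / pi + O(1) elements. *)

Set Implicit Arguments.
Unset Strict Implicit.
Unset Printing Implicit Defensive.

Import Order.TTheory GRing.Theory Num.Theory numFieldNormedType.Exports.

Local Open Scope classical_set_scope.
Local Open Scope ring_scope.

(** * Integration on a compact interval *)

(** The possible limits are fractions of the total length because an eigenfunction may vanish
    identically on whole edges, in a way that changes with [n] without any rule. There are only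
    finitely many sets of edges, so each ratio lies within O(1/n) of one of finitely many values,
    and the limit of a subsequence must be one of them.

    The potential is merely integrable: a solution has an absolutely continuous derivative but no
    pointwise second derivative. Absolute continuity in integral form and its product rule therefore
    replace calculus, and variation of constants uses only the L1 norm of [q]. Closeness of f alone
    would not bound its zeros from above; closeness of f' / m excludes two zeros within one
    half-period.

    Weyl's law is needed with an O(1) error in the square root and for all vertex conditions at
    once. The half-periods vanish at every edge end, so they lie in every form domain; the
    conditions at midpoints give their inequality on all of H^1, whatever happens at the ends. With
    d = 1 / k the form error is O(k) against k^2, which is an O(1) change of frequency. *)

Section interval_integral.
Context {R : realType}.
Notation mu := (@lebesgue_measure R).
Implicit Types (a b c x y z k : R) (f g h F G : R -> R).

Lemma ae_mono (P Q : R -> Prop) : (forall x, P x -> Q x) ->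
  {ae mu, forall x, P x} -> {ae mu, forall x, Q x}.
Proof. by move=> PQ; apply: filterS; first exact: (ae_filter_ringOfSetsType mu). Qed.

Lemma ae_and (P Q : R -> Prop) : {ae mu, forall x, P x} ->
  {ae mu, forall x, Q x} -> {ae mu, forall x, P x /\ Q x}.
Proof.
by move=> aP aQ; apply: filterI => //; exact: (ae_filter_ringOfSetsType mu).
Qed.

Definition L1 a b f := mu.-integrable `[a, b] (EFin \o f).
(** There is no orientation: for [b < a] the interval is empty and the integral is [0], hence the
    order hypotheses in the additivity statements. *)
Definition intg a b f : R := \int[mu]_(x in `[a, b]) f x.

Lemma L1_measurable a b f : L1 a b f -> measurable_fun `[a, b] f.
Proof. by move=> /(measurable_int mu) /measurable_EFinP. Qed.

Lemma L1_eq a b f g : (forall x, a <= x <= b -> f x = g x) ->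
  L1 a b f -> L1 a b g.
Proof.
move=> fg; apply: eq_integrable => // x /set_mem; rewrite /= in_itv/= => xab.
by rewrite /= fg.
Qed.

Lemma L1D a b f g : L1 a b f -> L1 a b g -> L1 a b (fun x => f x + g x).
Proof. by move=> /integrableD => H /H; apply => //. Qed.

Lemma L1Z a b k f : L1 a b f -> L1 a b (fun x => k * f x).
Proof. by move=> /(integrableZl _ k); apply. Qed.

Lemma L1N a b f : L1 a b f -> L1 a b (fun x => - f x).
Proof. by move=> /(L1Z (-1)); apply: L1_eq => x _; rewrite mulN1r. Qed.

Lemma L1B a b f g : L1 a b f -> L1 a b g -> L1 a b (fun x => f x - g x).
Proof. by move=> hf /L1N; exact: L1D. Qed.

Lemma L1_norm a b f : L1 a b f -> L1 a b (fun x => `|f x|).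
Proof. exact: integrable_norm. Qed.

Lemma L1_sub a b c d f : a <= c -> d <= b -> L1 a b f -> L1 c d f.
Proof.
move=> ac db; apply: integrableS => //.
by move=> x /=; rewrite !in_itv/= => /andP[? ?]; rewrite (le_trans ac)//= (le_trans _ db).
Qed.

Lemma L1_le a b f g : measurable_fun `[a, b] f ->
  (forall x, a <= x <= b -> `|f x| <= g x) -> L1 a b g -> L1 a b f.
Proof.
move=> mf fg; apply: le_integrable => //; first exact/measurable_EFinP.
move=> x /=; rewrite in_itv/= => xab; rewrite lee_fin.
by apply: (le_trans (fg _ xab)); exact: ler_norm.
Qed.

Lemma L1_cont a b f : {within `[a, b], continuous f} -> L1 a b f.
Proof.
by move=> cf; apply: continuous_compact_integrable => //; exact: segment_compact.
Qed.

Lemma continuous_within a b f : continuous f -> {within `[a, b], continuous f}.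
Proof. exact: continuous_subspaceT. Qed.

Lemma within_bounded a b f : {within `[a, b], continuous f} ->
  exists M : R, 0 <= M /\ forall x, a <= x <= b -> `|f x| <= M.
Proof.
move=> cf; have [ab|ba] := leP a b; last first.
  exists 0; split=> // x /andP[ax xb]; move: (le_lt_trans (le_trans ax xb) ba).
  by rewrite ltxx.
have cn : {within `[a, b], continuous (fun x => `|f x|)}.
  by move=> x; apply: continuous_comp; [exact: cf|exact: norm_continuous].
have [c cab Hc] := EVT_max ab cn.
exists `|f c|; split => // x xab; exact: Hc.
Qed.

Lemma L1_mul_cont a b f g : L1 a b f -> {within `[a, b], continuous g} ->
  L1 a b (fun x => f x * g x).
Proof.
move=> lf cg; have [M [M0 HM]] := within_bounded cg.
apply: (@L1_le _ _ _ (fun x => M * `|f x|)).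
- apply: measurable_funM; first exact: L1_measurable.
  exact: subspace_continuous_measurable_fun.
- by move=> x xab; rewrite normrM mulrC ler_wpM2r// HM.
- exact/L1Z/L1_norm.
Qed.

Lemma L1_cst a b k : L1 a b (fun=> k).
Proof. by apply: L1_cont; apply: continuous_within; exact: cst_continuous. Qed.

Lemma measurable_itvcc a b : measurable (`[a, b] : set R).
Proof. exact: measurable_itv. Qed.

Lemma intg_eq a b f g : (forall x, a <= x <= b -> f x = g x) ->
  intg a b f = intg a b g.
Proof.
by move=> fg; apply: eq_Rintegral => x /set_mem; rewrite /= in_itv/= => /fg.
Qed.

Lemma intgD a b f g : L1 a b f -> L1 a b g ->
  intg a b (fun x => f x + g x) = intg a b f + intg a b g.
Proof. by move=> *; rewrite /intg RintegralD. Qed.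

Lemma intgB a b f g : L1 a b f -> L1 a b g ->
  intg a b (fun x => f x - g x) = intg a b f - intg a b g.
Proof. by move=> *; rewrite /intg RintegralB. Qed.

Lemma intgZ a b k f : L1 a b f ->
  intg a b (fun x => k * f x) = k * intg a b f.
Proof. by move=> *; rewrite /intg RintegralZl. Qed.

Lemma intgN a b f : L1 a b f -> intg a b (fun x => - f x) = - intg a b f.
Proof.
by move=> lf; rewrite -mulN1r -intgZ//; apply: intg_eq => x _; rewrite mulN1r.
Qed.

Lemma intg_cst a b k : a <= b -> intg a b (fun=> k) = k * (b - a).
Proof.
move=> ab; rewrite /intg Rintegral_cst//= lebesgue_measure_itv/= lte_fin.
by case: ltgtP ab => // -> _; rewrite /= subrr.
Qed.

Lemma intg_le a b f g : L1 a b f -> L1 a b g ->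
  (forall x, a <= x <= b -> f x <= g x) -> intg a b f <= intg a b g.
Proof.
move=> lf lg fg; apply: le_Rintegral => // x; rewrite /= in_itv/=; exact: fg.
Qed.

Lemma intg_ge0 a b f : (forall x, a <= x <= b -> 0 <= f x) -> 0 <= intg a b f.
Proof. by move=> f0; apply: Rintegral_ge0 => x; rewrite /= in_itv/=; exact: f0. Qed.

Lemma intg_norm a b f : L1 a b f -> `|intg a b f| <= intg a b (fun x => `|f x|).
Proof. by move=> lf; exact: le_normr_Rintegral. Qed.

Lemma intgxx a f : intg a a f = 0.
Proof. by rewrite /intg set_itv1 Rintegral_set1. Qed.

Lemma intg_chasles a b c f : a <= b -> b <= c -> L1 a c f ->
  intg a c f = intg a b f + intg b c f.
Proof.
move=> ab bc lf; apply/eqP; rewrite addrC -subr_eq; apply/eqP.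
rewrite /intg Rintegral_itvB ?bnd_simp//.
rewrite Rintegral_itv_obnd_cbnd//.
apply: integrableS lf => //; apply: subset_itvr; by rewrite bnd_simp.
Qed.

(** Measurability of [g] is a separate hypothesis: agreement almost everywhere does not give it on a
    sigma-algebra that need not be complete. *)
Lemma intg_ae a b f g : L1 a b f -> measurable_fun `[a, b] g ->
  {ae mu, forall x, a <= x <= b -> f x = g x} -> L1 a b g /\ intg a b f = intg a b g.
Proof.
move=> lf mg fg.
have fg' : {ae mu, forall x, `[a, b]%classic x -> (f x)%:E = (g x)%:E}.
  by apply: ae_mono fg => x H; rewrite /= in_itv/= => /H ->.
split; last first.
  rewrite /intg /Rintegral; congr fine; apply: ae_eq_integral => //.
    by apply/measurable_EFinP; exact: (L1_measurable lf).
  exact/measurable_EFinP.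
case/integrableP: (lf) => mf lif; apply/integrableP; split; first exact/measurable_EFinP.
rewrite (le_lt_trans _ lif)//.
rewrite le_eqVlt; apply/orP; left; apply/eqP.
apply: ae_eq_integral => //.
- by apply/measurable_EFinP; apply: measurableT_comp.
- by apply/measurable_EFinP; apply: measurableT_comp => //; exact: L1_measurable.
- by apply: ae_mono fg' => x /= H /H [->].
Qed.

Lemma intg_eq0_ae a b f : L1 a b f -> (forall x, a <= x <= b -> 0 <= f x) ->
  intg a b f = 0 -> {ae mu, forall x, a <= x <= b -> f x = 0}.
Proof.
move=> lf f0 If.
have : {ae mu, forall x, `[a, b]%classic x -> (EFin \o f) x = 0%E}.
  apply/(ae_eq_integral_abs mu (measurable_itvcc a b)).
    by apply/measurable_EFinP; exact: (L1_measurable lf).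
  transitivity (\int[mu]_(x in `[a, b]) (f x)%:E)%E.
    apply: eq_integral => x /set_mem; rewrite /= in_itv/= => /f0 fx.
    by rewrite ger0_norm.
  rewrite -[LHS]fineK; last exact: integrable_fin_num.
  by move: If; rewrite /intg /Rintegral => ->.
by apply: ae_mono => x H xab; have /= := H _; rewrite in_itv/= => /(_ xab) [].
Qed.

End interval_integral.

(** * Absolutely continuous functions *)

Section absolute_continuity.
Context {R : realType}.
Notation mu := (@lebesgue_measure R).
Implicit Types (a b c d x y z k : R) (f g h F G V : R -> R).

Lemma within_sub a b c d f : a <= c -> d <= b ->
  {within `[a, b], continuous f} -> {within `[c, d], continuous f}.
Proof.
move=> ac db; apply: continuous_subspaceW => x /=; rewrite !in_itv/= => /andP[cx xd].
by rewrite (le_trans ac)//= (le_trans _ db).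
Qed.

(* Cut [a, b] into N pieces on which V grows by (V b - V a) / N. *)
Lemma quadratic_variation_const a b F V : a <= b ->
  {within `[a, b], continuous V} ->
  (forall x y, a <= x -> x <= y -> y <= b -> V x <= V y) ->
  (forall x y, a <= x -> x <= y -> y <= b -> `|F y - F x| <= (V y - V x) ^+ 2) ->
  F b = F a.
Proof.
move=> ab cV mV HF; set W := V b - V a.
have W0 : 0 <= W by rewrite subr_ge0 mV.
have step (N : nat) : (0 < N)%N -> `|F b - F a| <= W ^+ 2 / N%:R.
  move=> N0; have NR : 0 < N%:R :> R by rewrite ltr0n.
  have : forall i : nat, (i <= N)%N -> exists x, [/\ a <= x <= b,
      V x = V a + i%:R * (W / N%:R) & `|F x - F a| <= i%:R * (W / N%:R) ^+ 2].
    elim=> [_|i IH iN].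
      by exists a; rewrite lexx ab !mul0r addr0 subrr normr0.
    have [x [/andP[ax xb] Vx Fx]] := IH (ltnW iN).
    have [y] : exists2 y, y \in `[x, b] & V y = V a + i.+1%:R * (W / N%:R).
      apply: IVT => //; first exact: within_sub cV.
      have d0 : 0 <= W / N%:R by rewrite divr_ge0// ltW.
      apply/andP; split.
        rewrite ge_min Vx; apply/orP; left.
        by rewrite lerD2l ler_wpM2r// ler_nat.
      rewrite le_max; apply/orP; right.
      have -> : V b = V a + N%:R * (W / N%:R).
        by rewrite mulrC divfK ?gt_eqF// /W; ring.
      by rewrite lerD2l ler_wpM2r// ler_nat.
    rewrite in_itv/= => /andP[xy yb] Vy; exists y; split => //.
      by rewrite (le_trans ax).
    have := HF x y ax xy yb; rewrite Vx Vy.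
    have -> : V a + i.+1%:R * (W / N%:R) - (V a + i%:R * (W / N%:R)) = W / N%:R.
      rewrite -natr1; ring.
    move=> Hxy; have := ler_distD (F x) (F y) (F a) => /le_trans; apply.
    rewrite -natr1 mulrDl mul1r addrC; exact: lerD.
  move=> /(_ N (leqnn N)) [x [/andP[ax xb] Vx Fx]].
  (* The last cut point [x] need not be [b], but [V] takes the same value at both, so the quadratic
     bound forces [F b = F x]. *)
  have Vxb : V x = V b by rewrite Vx mulrC divfK ?gt_eqF// /W; ring.
  have := HF x b ax xb (lexx b).
  rewrite Vxb subrr expr0n/= normr_le0 subr_eq0 => /eqP ->.
  apply: (le_trans Fx); rewrite le_eqVlt; apply/orP; left; apply/eqP.
  by field; rewrite gt_eqF.
apply/eqP; rewrite -subr_eq0 -normr_le0; apply/ler_addgt0Pr => e e0.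
rewrite add0r; set N := (Num.truncn (W ^+ 2 / e)).+1.
apply: (le_trans (step N isT)).
rewrite ler_pdivrMr ?ltr0n// mulrC -ler_pdivrMr// ltW// /N.
by have /andP[] := Num.Theory.truncn_itv (divr_ge0 (sqr_ge0 W) (ltW e0)).
Qed.

(** Absolute continuity in integral form; [g] is one representative of the derivative of [f], so
    that no pointwise differentiability is involved. *)
Definition AC a b f g := L1 a b g /\ forall x, a <= x <= b -> f x = f a + intg a x g.

Lemma AC_L1 a b f g : AC a b f g -> L1 a b g. Proof. by case. Qed.

Lemma AC_intg a b f g x y : AC a b f g -> a <= x -> x <= y -> y <= b ->
  f y - f x = intg x y g.
Proof.
move=> [lg fE] ax xy yb; rewrite (fE y) ?(le_trans ax)// (fE x) ?ax ?(le_trans xy)//.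
rewrite (@intg_chasles _ a x y)//; first by ring.
exact: L1_sub lg.
Qed.

Lemma AC_sub a b c d f g : a <= c -> d <= b -> AC a b f g -> AC c d f g.
Proof.
move=> ac db fg; split; first exact: L1_sub (AC_L1 fg).
move=> x /andP[cx xd].
by rewrite -(AC_intg fg ac cx (le_trans xd db)) addrC subrK.
Qed.

Lemma AC_cont a b f g : AC a b f g -> {within `[a, b], continuous f}.
Proof.
move=> [lg fE]; have [ab|ba] := leP a b; last first.
  rewrite set_itv_ge ?bnd_simp -?ltNge//; exact: continuous_subspace0.
have := parameterized_integral_continuous ab lg => cI.
have : {within `[a, b], continuous (fun x => f a + parameterized_integral mu a x g)}.
  move=> x; apply: cvgD; [exact: cvg_cst|exact: cI].
apply: subspace_eq_continuous => x /set_mem; rewrite /= in_itv/= => xab.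
by rewrite /from_subspace/= (fE x xab).
Qed.

Lemma AC_eq a b f g f1 g1 :
  (forall x, a <= x <= b -> f x = f1 x) ->
  (forall x, a <= x <= b -> g x = g1 x) -> AC a b f g -> AC a b f1 g1.
Proof.
move=> ff gg [lg fE]; split; first exact: L1_eq lg.
move=> x /andP[ax xb]; rewrite -ff ?ax// -ff ?lexx ?(le_trans ax)//.
rewrite fE ?ax//; congr (_ + _); apply: intg_eq => y /andP[ay yx].
by rewrite gg// ay (le_trans yx).
Qed.

Lemma AC_cst a b k : AC a b (fun=> k) (fun=> 0).
Proof.
split; first exact: L1_cst.
by move=> x /andP[ax _]; rewrite intg_cst// mul0r addr0.
Qed.

Lemma ACD a b f g f1 g1 : AC a b f g -> AC a b f1 g1 ->
  AC a b (fun x => f x + f1 x) (fun x => g x + g1 x).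
Proof.
move=> [lg fE] [lg1 fE1]; split; first exact: L1D.
move=> x /andP[ax xb]; rewrite fE ?ax// fE1 ?ax// intgD; first by ring.
  exact: L1_sub lg.
exact: L1_sub lg1.
Qed.

Lemma ACZ a b k f g : AC a b f g -> AC a b (fun x => k * f x) (fun x => k * g x).
Proof.
move=> [lg fE]; split; first exact: L1Z.
move=> x /andP[ax xb]; rewrite fE ?ax// intgZ; first by ring.
exact: L1_sub lg.
Qed.

Lemma ACN a b f g : AC a b f g -> AC a b (fun x => - f x) (fun x => - g x).
Proof. by move=> /(ACZ (-1)); apply: AC_eq => x _; rewrite mulN1r. Qed.

Lemma ACB a b f g f1 g1 : AC a b f g -> AC a b f1 g1 ->
  AC a b (fun x => f x - f1 x) (fun x => g x - g1 x).
Proof. by move=> fg /ACN; exact: ACD. Qed.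

Lemma AC_primitive a b k g : L1 a b g -> AC a b (fun x => k + intg a x g) g.
Proof. by move=> lg; split => // x xab; rewrite intgxx addr0. Qed.

Lemma AC_integrand_ae a b f g g1 : measurable_fun `[a, b] g1 ->
  {ae mu, forall x, a <= x <= b -> g x = g1 x} -> AC a b f g -> AC a b f g1.
Proof.
move=> mg1 gg1 [lg fE]; have [lg1 _] := intg_ae lg mg1 gg1; split => // x /andP[ax xb].
rewrite fE ?ax//; congr (_ + _).
have l1x : L1 a x g by exact: L1_sub lg.
apply: (proj2 (intg_ae l1x _ _)).
  by apply: L1_measurable; exact: L1_sub lg1.
by apply: ae_mono gg1 => y H /andP[ay yx]; rewrite H// ay (le_trans yx).
Qed.

(* Over [x, y] the increment of f f1 differs from the integral of g f1 + f g1 by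
   at most (V y - V x)^2, where V is a primitive of |g| + |g1|. *)
Lemma AC_mul a b f g f1 g1 : AC a b f g -> AC a b f1 g1 ->
  AC a b (fun x => f x * f1 x) (fun x => g x * f1 x + f x * g1 x).
Proof.
move=> fg fg1.
have cf := AC_cont fg; have cf1 := AC_cont fg1.
have lg := AC_L1 fg; have lg1 := AC_L1 fg1.
have lgf1 : L1 a b (fun x => g x * f1 x) by exact: L1_mul_cont.
have lfg1 : L1 a b (fun x => f x * g1 x).
  by apply: L1_eq (L1_mul_cont lg1 cf) => x _; rewrite mulrC.
set p := (fun x => g x * f1 x + f x * g1 x).
have lp : L1 a b p by exact: L1D.
split=> // t /andP[at_ tb].
pose v x := `|g x| + `|g1 x|.
have lv : L1 a b v by apply: L1D; exact: L1_norm.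
pose V := fun x => 0 + intg a x v.
have ACV : AC a b V v by exact: AC_primitive.
pose H := fun x => f x * f1 x - intg a x p.
suff : H t = H a by rewrite /H intgxx subr0 => <-; rewrite subrK.
apply: (@quadratic_variation_const _ _ _ V) => //.
- exact: within_sub (AC_cont ACV).
- move=> x y ax xy yt; rewrite -subr_ge0 (AC_intg ACV)//; last exact: le_trans tb.
  by apply: intg_ge0 => z _; rewrite addr_ge0.
move=> x y ax xy yt; have yb := le_trans yt tb.
have sub h : L1 a b h -> L1 x y h by exact: L1_sub.
(* The factors are frozen at opposite ends, [f1] at [y] and [f] at [x], because f y f1 y - f x f1 x
   = f1 y (f y - f x) + f x (f1 y - f1 x). What remains is a product of a derivative and an
   oscillation, each controlled by [v]. *)
have -> : H y - H x = intg x y (fun s => g s * (f1 y - f1 s) - g1 s * (f s - f x)).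
  have -> : intg x y (fun s => g s * (f1 y - f1 s) - g1 s * (f s - f x)) =
    intg x y (fun s => f1 y * g s + f x * g1 s - p s).
    by apply: intg_eq => s _; rewrite /p; ring.
  rewrite intgB; last 2 first.
  - by apply: L1D; apply: L1Z; exact: sub.
  - exact: sub.
  rewrite intgD ?intgZ; try by [apply: L1Z; exact: sub|exact: sub].
  rewrite -(AC_intg fg)// -(AC_intg fg1)// /H.
  rewrite (@intg_chasles _ a x y p)//; last exact: L1_sub lp.
  ring.
set A := intg x y v.
have VA : V y - V x = A by rewrite (AC_intg ACV).
have osc F f2 g2 : AC a b f2 g2 -> (forall s, `|g2 s| <= v s) ->
    forall s s', x <= s -> s <= s' -> s' <= y -> `|f2 s' - f2 s| <= A.
  move=> fg2 g2v s s' xs ss' s'y.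
  have as_ := le_trans ax xs; have s'b := le_trans s'y yb.
  rewrite (AC_intg fg2)//; apply: le_trans (intg_norm _) _.
    by apply: L1_sub (AC_L1 fg2).
  apply: (@le_trans _ _ (intg s s' v)).
    apply: intg_le; [apply/L1_norm| |] => //.
    - exact: L1_sub (AC_L1 fg2).
    - exact: L1_sub lv.
  rewrite -(AC_intg ACV)// -VA.
  have m u u' : a <= u -> u <= u' -> u' <= b -> V u <= V u'.
    move=> *; rewrite -subr_ge0 (AC_intg ACV)//.
    by apply: intg_ge0 => z _; rewrite addr_ge0.
  have := m s' y (le_trans as_ ss') s'y yb; have := m x s ax xs (le_trans ss' s'b).
  lra.
have gv s : `|g s| <= v s by rewrite lerDl.
have g1v s : `|g1 s| <= v s by rewrite lerDr.
apply: le_trans (intg_norm _) _.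
  apply: L1B; apply: L1_mul_cont; [exact: sub| |exact: sub|].
  - move=> s; apply: cvgB; [exact: cvg_cst|exact: (within_sub ax yb cf1)].
  - move=> s; apply: cvgB; [exact: (within_sub ax yb cf)|exact: cvg_cst].
rewrite VA expr2 {1}/A -intgZ; last exact: sub.
have le_A s : x <= s <= y -> `|g s * (f1 y - f1 s) - g1 s * (f s - f x)| <= A * v s.
  move=> /andP[xs sy]; apply: le_trans (ler_normB _ _) _.
  rewrite !normrM /v mulrDr lerD// mulrC ler_wpM2r//.
  - exact: (osc f _ _ fg1).
  - exact: (osc f _ _ fg).
apply: intg_le => //; last exact/L1Z/sub.
apply: L1_norm.
apply: L1B; apply: L1_mul_cont; [exact: sub| |exact: sub|].
- move=> s; apply: cvgB; [exact: cvg_cst|exact: (within_sub ax yb cf1)].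
- move=> s; apply: cvgB; [exact: (within_sub ax yb cf)|exact: cvg_cst].
Qed.

Lemma AC_C1 a b F f : (forall x, a <= x <= b -> is_derive x 1 F (f x)) ->
  {within `[a, b], continuous f} -> AC a b F f.
Proof.
move=> dF cf; split; first exact: L1_cont.
move=> x /andP[ax xb]; move: ax; rewrite le_eqVlt => /predU1P[<-|ax].
  by rewrite intgxx addr0.
have dc y : a <= y <= b -> {for y, continuous F}.
  move=> yab; apply/differentiable_continuous/derivable1_diffP.
  by have [] := dF y yab.
rewrite /intg /Rintegral (@continuous_FTC2 _ f F a x)//=; first by ring.
- exact: within_sub cf.
- split.
  + move=> y; rewrite in_itv/= => /andP[ay yx].
    have yab : a <= y <= b by rewrite ltW//= (le_trans (ltW yx)).
    by have [] := dF y yab.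
  + by apply: cvg_at_right_filter; apply: dc; rewrite lexx/= (le_trans (ltW ax)).
  + by apply: cvg_at_left_filter; apply: dc; rewrite (ltW ax).
- move=> y; rewrite in_itv/= => /andP[ay yx].
  have yab : a <= y <= b by rewrite ltW//= (le_trans (ltW yx)).
  by rewrite derive1E; apply: derive_val; exact: dF.
Qed.

End absolute_continuity.

(** * The eigenvalue equation on an edge *)

Section square_integrable.
Context {R : realType}.
Notation mu := (@lebesgue_measure R).
Implicit Types (a b c d x y z k l : R) (f g h p q r : R -> R).

(** Measurability of [g] does not follow from that of its square. *)
Definition L2 a b g := measurable_fun `[a, b] g /\ L1 a b (fun x => g x ^+ 2).

Lemma L2_mul a b f g : L2 a b f -> L2 a b g -> L1 a b (fun x => f x * g x).
Proof.
move=> [mf lf] [mg lg]; apply: L1_le (L1D lf lg); first exact: measurable_funM.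
move=> x _; rewrite normrM; have := sqr_ge0 (`|f x| - `|g x|).
rewrite -(real_normK (num_real (f x))) -(real_normK (num_real (g x))).
have := normr_ge0 (f x); have := normr_ge0 (g x); nra.
Qed.

Lemma L2_cont a b f : {within `[a, b], continuous f} -> L2 a b f.
Proof.
move=> cf; split; first exact: (L1_measurable (L1_cont cf)).
by apply: L1_eq (L1_mul_cont (L1_cont cf) cf) => x _; rewrite expr2.
Qed.

Lemma L2_L1 a b f : L2 a b f -> L1 a b f.
Proof.
move=> hf; have h1 : L2 a b (fun=> 1).
  by apply/L2_cont/continuous_within; exact: cst_continuous.
by apply: L1_eq (L2_mul hf h1) => x _; rewrite mulr1.
Qed.

Lemma L2D a b f g : L2 a b f -> L2 a b g -> L2 a b (fun x => f x + g x).
Proof.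
move=> hf hg; have [mf lf] := hf; have [mg lg] := hg.
split; first exact: measurable_funD.
apply: L1_eq (L1D (L1D lf lg) (L1Z 2 (L2_mul hf hg))) => x _; ring.
Qed.

Lemma L2Z a b k f : L2 a b f -> L2 a b (fun x => k * f x).
Proof.
move=> [mf lf]; split.
  by apply: measurable_funM => //; exact: measurable_cst.
by apply: L1_eq (L1Z (k ^+ 2) lf) => x _; rewrite exprMn.
Qed.

Lemma L2B a b f g : L2 a b f -> L2 a b g -> L2 a b (fun x => f x - g x).
Proof.
move=> hf /(L2Z (-1)) hg; have := L2D hf hg.
by under [X in L2 _ _ X]eq_fun => x do rewrite mulN1r.
Qed.

Lemma L2_sub a b c d f : a <= c -> d <= b -> L2 a b f -> L2 c d f.
Proof.
move=> ac db hf; split; last exact: L1_sub (hf.2).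
exact: L1_measurable (L1_sub ac db (L2_L1 hf)).
Qed.

(* Test with h' = g - Q minus its mean, where Q is a primitive of r. *)
Lemma du_bois_reymond l f g r : 0 < l -> AC 0 l f g -> L2 0 l g -> L1 0 l r ->
  (forall h h', AC 0 l h h' -> L2 0 l h' -> h 0 = 0 -> h l = 0 ->
    intg 0 l (fun x => g x * h' x) + intg 0 l (fun x => r x * h x) = 0) ->
  exists p, [/\ AC 0 l f p, AC 0 l p r &
    {ae mu, forall x, 0 <= x <= l -> g x = p x}].
Proof.
move=> l0 fg g2 r1 weak.
pose Q x := 0 + intg 0 x r; have QAC : AC 0 l Q r by exact: AC_primitive.
have Q2 : L2 0 l Q by exact/L2_cont/AC_cont/QAC.
have u2 := L2B g2 Q2; set u := (fun x => g x - Q x) in u2.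
pose m := intg 0 l u / l.
have m2 : L2 0 l (fun=> m) by apply/L2_cont/continuous_within; exact: cst_continuous.
have phi2 := L2B u2 m2; set phi := (fun x => u x - m) in phi2.
have phi1 := L2_L1 phi2.
pose h x := 0 + intg 0 x phi; have hAC : AC 0 l h phi by exact: AC_primitive.
have h0 : h 0 = 0 by rewrite /h intgxx addr0.
have hl : h l = 0.
  rewrite /h intgB ?intg_cst ?subr0 ?divfK ?ltW ?gt_eqF//; try exact: L2_L1.
  by rewrite subrr addr0.
have := weak _ _ hAC phi2 h0 hl.
(* Since [Q h] vanishes at both ends, the integral of [r h] is minus that of [Q phi]. The weak
   equation then says that [phi] is orthogonal to [g - Q]; as [phi] is also orthogonal to constants,
   it is orthogonal to itself. *)
have Qh := AC_mul QAC hAC.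
have := AC_intg Qh (lexx 0) (ltW l0) (lexx l); rewrite h0 hl !mulr0 subr0.
have rh1 : L1 0 l (fun x => r x * h x) by apply: L1_mul_cont => //; exact: AC_cont hAC.
rewrite intgD//; last exact: L2_mul.
move=> E1 E2.
have E3 : intg 0 l (fun x => phi x ^+ 2) = 0.
  transitivity (intg 0 l (fun x => (g x * phi x - Q x * phi x) - m * phi x)).
    by apply: intg_eq => x _; rewrite /phi /u; ring.
  rewrite intgB; [|by apply: L1B; exact: L2_mul|exact: L1Z].
  rewrite intgB; [|exact: L2_mul..].
  have -> : intg 0 l (fun x => m * phi x) = 0.
    by rewrite intgZ//; move: hl; rewrite /h add0r => ->; rewrite mulr0.
  move: E1 E2; lra.
have phi0 : {ae mu, forall x, 0 <= x <= l -> g x = m + intg 0 x r}.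
  apply: ae_mono (intg_eq0_ae phi2.2 (fun x _ => sqr_ge0 _) E3) => x H /H /eqP.
  rewrite sqrf_eq0 /phi /u /Q => /eqP; lra.
have pAC := @AC_primitive _ 0 l m _ r1.
exists (fun x => m + intg 0 x r); split=> //.
apply: AC_integrand_ae phi0 fg; exact: L1_measurable (L1_cont (AC_cont pAC)).
Qed.

End square_integrable.

(** * High-frequency solutions are close to sine waves *)

Section sine_approximation.
Context {R : realType}.
Implicit Types (a b c d x y z k l m s A th : R) (f g h p q r : R -> R).

(** The bound on the phase is what later makes the count of zeros independent of it, up to a
    constant. *)
Lemma polar_coordinates c s : exists A ph, [/\ 0 <= A, - pi <= ph <= pi,
  c = A * sin ph & s = A * cos ph].
Proof.
set A := Num.sqrt (c ^+ 2 + s ^+ 2).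
have A2 : A ^+ 2 = c ^+ 2 + s ^+ 2 by rewrite sqr_sqrtr// addr_ge0// sqr_ge0.
have A0 : 0 <= A by exact: sqrtr_ge0.
have [AE|Ap] := eqVneq A 0.
  exists 0, 0; move: A2; rewrite AE expr0n/= => /esym/eqP.
  rewrite paddr_eq0 ?sqr_ge0// !sqrf_eq0 => /andP[/eqP -> /eqP ->].
  by rewrite !mul0r lexx oppr_le0 pi_ge0.
have Agt : 0 < A by rewrite lt_neqAle eq_sym Ap.
have sA : -1 <= s / A <= 1.
  rewrite -ler_norml normrM normfV (ger0_norm A0) ler_pdivrMr// mul1r.
  rewrite -ler_sqr ?nnegrE// A2 real_normK ?num_real// lerDr sqr_ge0//.
have cosE : cos (acos (s / A)) = s / A by rewrite acosK// in_itv/=.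
have sinE : sin (acos (s / A)) = `|c| / A.
  rewrite sin_acos//.
  have -> : 1 - (s / A) ^+ 2 = (`|c| / A) ^+ 2.
    rewrite !expr_div_n real_normK ?num_real// A2; field.
    by rewrite -A2 sqrf_eq0.
  by rewrite sqrtr_sqr ger0_norm// divr_ge0.
have a0 := acos_ge0 sA; have api := acos_lepi sA.
have [c0|c0] := leP 0 c.
  exists A, (acos (s / A)); rewrite cosE sinE ger0_norm// !(mulrC A) !divfK//.
  by split => //; rewrite api (le_trans _ a0)// oppr_le0 pi_ge0.
exists A, (- acos (s / A)); rewrite cosN sinN cosE sinE ltr0_norm//.
rewrite mulNr opprK !(mulrC A) !divfK//.
by split => //; rewrite lerN2 api/= (le_trans _ (pi_ge0 R))// oppr_le0.
Qed.

Lemma is_derive_sin_lin m x :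
  is_derive x 1 (fun x => sin (m * x) : R) (m * cos (m * x)).
Proof.
have H : is_derive x 1 (fun x => m * x : R) m.
  by apply: is_derive_eq; rewrite /GRing.scale/= mulr1.
have := is_derive1_comp (is_derive_sin (m * x)) H; rewrite mulrC; exact.
Qed.

Lemma is_derive_cos_lin m x :
  is_derive x 1 (fun x => cos (m * x) : R) (- m * sin (m * x)).
Proof.
have H : is_derive x 1 (fun x => m * x : R) m.
  by apply: is_derive_eq; rewrite /GRing.scale/= mulr1.
have := is_derive1_comp (is_derive_cos (m * x)) H; rewrite mulrC mulrN -mulNr; exact.
Qed.

Lemma continuous_sin_lin m : continuous (fun x => sin (m * x) : R).
Proof.
move=> x; apply: continuous_comp; last exact: continuous_sin.
exact: mulrl_continuous.
Qed.

Lemma continuous_cos_lin m : continuous (fun x => cos (m * x) : R).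
Proof.
move=> x; apply: continuous_comp; last exact: continuous_cos.
exact: mulrl_continuous.
Qed.

Lemma AC_sin a b m : AC a b (fun x => sin (m * x)) (fun x => m * cos (m * x)).
Proof.
apply: AC_C1; first by move=> x _; exact: is_derive_sin_lin.
apply: continuous_within => x; apply: cvgM; [exact: cvg_cst|exact: continuous_cos_lin].
Qed.

Lemma AC_cos a b m : AC a b (fun x => cos (m * x)) (fun x => - m * sin (m * x)).
Proof.
apply: AC_C1; first by move=> x _; exact: is_derive_cos_lin.
apply: continuous_within => x; apply: cvgM; [exact: cvg_cst|exact: continuous_sin_lin].
Qed.

(* Variation of constants: f cos - p sin / m and f sin + p cos / m vary by
   at most sup |f| * intg |q| / m. *)
Lemma sine_approximation l m f p q : 0 < l -> 0 < m -> L1 0 l q ->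
  16 * intg 0 l (fun x => `|q x|) <= m ->
  AC 0 l f p -> AC 0 l p (fun x => (q x - m ^+ 2) * f x) ->
  exists A ph, [/\ 0 <= A, - pi <= ph <= pi &
    forall x, 0 <= x <= l ->
      `|f x - A * sin (m * x + ph)| <= A / 4 /\
      `|p x / m - A * cos (m * x + ph)| <= A / 4].
Proof.
move=> l0 m0 lq mq fAC pAC; set Qn := intg 0 l _ in mq.
have m_neq0 : m != 0 by rewrite gt_eqF.
have cf := AC_cont fAC.
have cnf : {within `[0, l], continuous (fun x => `|f x|)}.
  by move=> x; apply: continuous_comp; [exact: cf|exact: norm_continuous].
have [xM xMl HM] := EVT_max (ltW l0) cnf; set M := `|f xM| in HM.
have M0 : 0 <= M by rewrite normr_ge0.
have fM x : 0 <= x <= l -> `|f x| <= M by move=> xl; exact: HM.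
pose t u x := q x * f x * u (m * x) / m.
have t1 (u : R -> R) : continuous (fun x => u (m * x)) -> L1 0 l (t u).
  move=> cu; apply: (@L1_eq _ _ _ (fun x => m^-1 * ((q x * f x) * u (m * x)))).
    by move=> x _; rewrite /t; ring.
  by apply/L1Z/L1_mul_cont; [apply: L1_mul_cont|exact: continuous_within].
(* The [16] of the hypothesis is spent here: each of the two coefficients [c] and [s] below moves by
   at most [M / 16], and together they give an error [M / 8]. *)
have tle (u : R -> R) x : continuous (fun x => u (m * x)) -> (forall y, `|u y| <= 1) ->
    0 <= x <= l -> `|intg 0 x (t u)| <= M / 16.
  move=> cu u1 /andP[x0 xl]; apply: le_trans (intg_norm _) _; first exact: L1_sub (t1 _ cu).
  have lMq : L1 0 l (fun y => M / m * `|q y|) by exact/L1Z/L1_norm.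
  apply: (@le_trans _ _ (intg 0 x (fun y => M / m * `|q y|))).
    apply: intg_le; [|exact: L1_sub lMq|].
      by apply: L1_sub (L1_norm (t1 _ cu)).
    move=> y /andP[y0 yx]; rewrite /t !normrM normfV (gtr0_norm m0).
    have fu : `|f y| * `|u (m * y)| <= M.
      by rewrite -[leRHS]mulr1 ler_pM// fM// y0 (le_trans yx).
    rewrite [leRHS]mulrAC ler_wpM2r ?invr_ge0 ?(ltW m0)//.
    by have := ler_wpM2l (normr_ge0 (q y)) fu; rewrite mulrA (mulrC _ M).
  apply: (@le_trans _ _ (M / m * Qn)).
    rewrite /Qn -intgZ ?(@intg_chasles _ 0 x l)//; try exact: L1_norm.
    rewrite lerDl intg_ge0// => y _; rewrite mulr_ge0// divr_ge0// ltW//.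
  rewrite mulrAC -mulrA ler_wpM2l// ler_pdivrMr// mulrC ler_pdivlMr//.
  by rewrite mulrC.
pose c x := f x * cos (m * x) - p x * sin (m * x) / m.
pose s x := f x * sin (m * x) + p x * cos (m * x) / m.
have cAC : AC 0 l c (fun x => - t sin x).
  apply: AC_eq (ACB (AC_mul fAC (AC_cos 0 l m))
    (ACZ m^-1 (AC_mul pAC (AC_sin 0 l m)))) => x _; rewrite /c /t.
    by rewrite [m^-1 * _]mulrC.
  by field.
have sAC : AC 0 l s (t cos).
  apply: AC_eq (ACD (AC_mul fAC (AC_sin 0 l m))
    (ACZ m^-1 (AC_mul pAC (AC_cos 0 l m)))) => x _; rewrite /s /t.
    by rewrite [m^-1 * _]mulrC.
  by field.
have cle x : 0 <= x <= l -> `|c x - c 0| <= M / 16.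
  move=> xl; have /andP[x0 x1] := xl; rewrite (AC_intg cAC)// intgN.
    rewrite normrN; apply: tle => //; [exact: continuous_sin_lin|exact: sin_max].
  by apply: (L1_sub (lexx 0) x1); apply: t1; exact: continuous_sin_lin.
have sle x : 0 <= x <= l -> `|s x - s 0| <= M / 16.
  move=> xl; have /andP[x0 x1] := xl; rewrite (AC_intg sAC)//.
  apply: tle => //; [exact: continuous_cos_lin|exact: cos_max].
have [A [ph [A0 phpi cE sE]]] := polar_coordinates (c 0) (s 0).
have fE x : f x - A * sin (m * x + ph) =
    (c x - c 0) * cos (m * x) + (s x - s 0) * sin (m * x).
  rewrite sinD cE sE.
  have -> : f x = c x * cos (m * x) + s x * sin (m * x).
    rewrite /c /s -[LHS]mulr1 -(cos2Dsin2 (m * x)); ring.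
  ring.
have pE x : p x / m - A * cos (m * x + ph) =
    (s x - s 0) * cos (m * x) - (c x - c 0) * sin (m * x).
  rewrite cosD cE sE.
  have -> : p x / m = s x * cos (m * x) - c x * sin (m * x).
    rewrite /c /s -[LHS]mulr1 -(cos2Dsin2 (m * x)); ring.
  ring.
have err x : 0 <= x <= l -> `|f x - A * sin (m * x + ph)| <= M / 8 /\
      `|p x / m - A * cos (m * x + ph)| <= M / 8.
  move=> xl; have -> : M / 8 = M / 16 * 1 + M / 16 * 1 by field.
  rewrite fE pE; split.
    apply: le_trans (ler_normD _ _) _; rewrite !normrM.
    by apply: lerD; apply: ler_pM => //; rewrite ?cle ?sle ?cos_max ?sin_max.
  apply: le_trans (ler_normB _ _) _; rewrite !normrM.
  by apply: lerD; apply: ler_pM => //; rewrite ?cle ?sle ?cos_max ?sin_max.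
(* At a point where [|f|] is maximal, M <= A + M / 8. This turns an error relative to the supremum
   of [|f|] into one relative to the amplitude, so that [A = 0] will force [f] to vanish. *)
have MA : M / 8 <= A / 4.
  have xl : 0 <= xM <= l by move: xMl; rewrite in_itv.
  have [e1 _] := err _ xl.
  have := ler_distD (A * sin (m * xM + ph)) (f xM) 0; rewrite !subr0 -/M.
  have : `|A * sin (m * xM + ph)| <= A.
    by rewrite normrM (ger0_norm A0) -[leRHS]mulr1 ler_wpM2l// sin_max.
  move: e1 M0 A0; lra.
exists A, ph; split => // x xl; have [e1 e2] := err _ xl.
by split; [exact: le_trans MA|exact: le_trans MA].
Qed.

End sine_approximation.

(** * Zeros of a function close to a sine wave *)

Section zeros.
Context {R : realType}.
Implicit Types (a b c d x y z k l m s A th ph : R) (f g h p q r : R -> R).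

(** The zeros [a j] lie strictly inside the edge: a component of the nonzero set that meets such an
    interval is confined to it and cannot escape through a vertex. The points [t j] witness that
    there is such a component. *)
Definition alternates (n : nat) l f := exists a t : nat -> R, forall j, (j < n)%N ->
  [/\ 0 < a j, a j < t j, t j < a j.+1, a j.+1 < l &
  [/\ f (a j) = 0, f (a j.+1) = 0 & f (t j) != 0]].

(** The tolerance [A / 4] is small enough for [f] to have the sign of the sine at its extrema, and
    for [p] to keep its sign wherever the sine is at most 1/4 in absolute value. *)
Definition sine_close l m A ph f p := forall x, 0 <= x <= l ->
  `|f x - A * sin (m * x + ph)| <= A / 4 /\
  `|p x / m - A * cos (m * x + ph)| <= A / 4.

(* At the nodes sin (m x + ph) = +- 1.  Since ph lies in [-pi, pi], node 0 is
   negative, so that the nodes with j : nat cut up the whole of [0, l]. *)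
Let node m ph (j : nat) : R := (- (3 / 2 * pi) + pi *+ j - ph) / m.

Let nodeE m ph j x : m != 0 ->
  m * x + ph = (m * (x - node m ph j) - pi / 2) - pi + pi *+ j.
Proof. by move=> m0; rewrite /node; field. Qed.

Let nodeS m ph j : m != 0 -> node m ph j.+1 = node m ph j + pi / m.
Proof. by move=> m0; rewrite /node mulrS; field. Qed.

(** After multiplication by this sign the sine rises from -1 to 1 between node [j] and node [j.+1],
    so that both parities are treated alike. *)
Let sgj (j : nat) : R := (-1) ^+ j.+1.

Let sin_node m ph j x : m != 0 ->
  sin (m * x + ph) = sgj j * sin (m * (x - node m ph j) - pi / 2).
Proof.
move=> m0; rewrite (nodeE ph j)// (alternatingn (@sinDpi R)).
rewrite -[in RHS](subrK pi (m * _ - _)) sinDpi /sgj exprS; ring.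
Qed.

Let cos_node m ph j x : m != 0 ->
  cos (m * x + ph) = sgj j * cos (m * (x - node m ph j) - pi / 2).
Proof.
move=> m0; rewrite (nodeE ph j)// (alternatingn (@cosDpi R)).
rewrite -[in RHS](subrK pi (m * _ - _)) cosDpi /sgj exprS; ring.
Qed.

Let close_node l m A ph f p j x : m != 0 -> sine_close l m A ph f p -> 0 <= x <= l ->
  let th := m * (x - node m ph j) - pi / 2 in
  `|sgj j * f x - A * sin th| <= A / 4 /\ `|sgj j * p x / m - A * cos th| <= A / 4.
Proof.
move=> m0 cl xl th; have [] := cl x xl.
rewrite (sin_node ph j)// (cos_node ph j)// -/th => h1 h2.
have sg2 : sgj j * sgj j = 1 by rewrite -expr2 sqrr_sign.
have sgn z : `|sgj j * z| = `|z| by rewrite normrM normrX normrN1 expr1n mul1r.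
split.
  rewrite -sgn mulrBr mulrA sg2 mul1r (_ : sgj j * (A * _) = A * (sgj j * sin th))//.
  by ring.
rewrite -sgn mulrBr !mulrA sg2 mul1r.
by rewrite (_ : sgj j * A * _ = A * (sgj j * cos th))//; ring.
Qed.

(** At a zero of [f] the sine is at most 1/4 in absolute value. It is monotone between two nodes, so
    this holds all the way between two zeros; there the cosine, up to sign, is at least 1/2 and the
    derivative [p], up to sign, at least [A * m / 4]. The integral of [p] between the zeros could
    then not vanish. *)
Let one_zero l m A ph f p j z z' : 0 < m -> 0 < A -> sine_close l m A ph f p ->
  AC 0 l f p -> 0 <= z -> z < z' -> z' <= l -> f z = 0 -> f z' = 0 ->
  node m ph j <= z -> z' <= node m ph j.+1 -> False.
Proof.
move=> m0 A0 cl fp z0 zz' z'l fz fz' jz z'j.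
have m_neq0 : m != 0 by rewrite gt_eqF.
have /andP[sz0 sz1] : 0 <= z <= l by rewrite z0 (le_trans (ltW zz')).
pose th x := m * (x - node m ph j) - pi / 2.
have thP x : z <= x -> x <= z' -> th x \in `[(- (pi / 2)), pi / 2].
  move=> zx xz'; rewrite in_itv/= /th lerBrDr addNr mulr_ge0 ?(ltW m0)//=; last first.
    by rewrite subr_ge0 (le_trans jz).
  rewrite lerBlDr (_ : pi / 2 + pi / 2 = pi)//; last by field.
  rewrite mulrC -ler_pdivlMr// lerBlDr addrC -nodeS//; exact: le_trans xz' z'j.
have sin_le u v : z <= u -> u <= v -> v <= z' -> sin (th u) <= sin (th v).
  move=> zu uv vz'; move: uv; rewrite le_eqVlt => /predU1P[->//|uv].
  rewrite ltW// ltr_sin ?thP// ?(le_trans zu (ltW uv))// ?(le_trans (ltW uv) vz')//.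
  by rewrite /th ltrD2r ltr_pM2l// ltrD2r.
have sinz x : 0 <= x <= l -> f x = 0 -> `|sin (th x)| <= 1 / 4.
  move=> xl fx; have [+ _] := close_node j m_neq0 cl xl.
  rewrite fx mulr0 sub0r normrN normrM gtr0_norm// -/(th x) [leRHS]mulrC.
  by rewrite [leRHS]mulrC ler_pM2l// mul1r.
have pbig x : z <= x <= z' -> A * m / 4 <= sgj j * p x.
  move=> /andP[zx xz'].
  have xl : 0 <= x <= l by rewrite (le_trans z0)//= (le_trans xz').
  have [_ +] := close_node j m_neq0 cl xl; rewrite -/(th x) => hp.
  have h1 := sin_le z x (lexx z) zx xz'; have h2 := sin_le x z' zx xz' (lexx z').
  have s1 := sinz z (introT andP (conj sz0 sz1)) fz.
  have s2 : `|sin (th z')| <= 1 / 4 by apply: sinz; rewrite ?z'l ?(le_trans z0 (ltW zz')).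
  have sx : `|sin (th x)| <= 1 / 4.
    move: s1 s2; rewrite !ler_norml => /andP[? ?] /andP[? ?].
    by apply/andP; split; [exact: le_trans h1|exact: le_trans h2 _].
  have c0 : 0 <= cos (th x) by apply: cos_ge0_pihalf; have := thP x zx xz'; rewrite in_itv.
  have c1 : 1 / 2 <= cos (th x).
    rewrite leNgt; apply/negP => c2; have := cos2Dsin2 (th x).
    move: sx; rewrite ler_norml => /andP[sx1 sx2] E.
    have : cos (th x) ^+ 2 <= 1 / 4 by nra.
    have : sin (th x) ^+ 2 <= 1 / 16 by nra.
    lra.
  move: hp; rewrite ler_norml => /andP[+ _]; rewrite lerBrDr => hp.
  rewrite mulrAC -ler_pdivlMr//; apply: le_trans hp; nra.
have := AC_intg fp z0 (ltW zz') z'l; rewrite fz fz' subrr => /esym I0.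
have lp : L1 z z' p by exact: L1_sub (AC_L1 fp).
have : A * m / 4 * (z' - z) <= sgj j * intg z z' p.
  by rewrite -intgZ// -intg_cst ?(ltW zz')//; apply: intg_le => //;
    [exact: L1_cst|exact: L1Z].
rewrite I0 mulr0 leNgt => /negP; apply.
by rewrite mulr_gt0 ?subr_gt0// divr_gt0// mulr_gt0.
Qed.

Lemma sine_close_zeros_le l m A ph f p : 0 < l -> 0 < m -> 0 < A ->
  - pi <= ph <= pi -> sine_close l m A ph f p -> AC 0 l f p ->
  exists2 Z : seq R, (size Z = (Num.truncn (m * l / pi)).+4)%N &
    forall x, 0 <= x <= l -> f x = 0 -> x \in Z.
Proof.
move=> l0 m0 A0 /andP[ph0 ph1] cl fp; set J := Num.truncn _.
have m_neq0 : m != 0 by rewrite gt_eqF.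
pose Pz j x := [/\ 0 <= x <= l, f x = 0, node m ph j <= x & x <= node m ph j.+1].
(* One zero is picked in each node interval, with [0] as default where there is none. The list may
   contain other points than zeros; only its length and the fact that no zero is missed matter. *)
exists [seq xget 0 [set x | Pz j x] | j <- iota 0 J.+4].
  by rewrite size_map size_iota.
move=> x xl fx.
have pi0 := pi_gt0 R; have pi_neq0 : (pi : R) != 0 by rewrite gt_eqF.
pose v := (m * x + ph + 3 / 2 * pi) / pi.
have v0 : 0 <= v.
  have /andP[x0 _] := xl; rewrite divr_ge0// ?(ltW pi0)//.
  have : 0 <= m * x by rewrite mulr_ge0// ltW.
  move: ph0 pi0; lra.
have /andP[jv vj] := Num.Theory.truncn_itv v0; set j := Num.truncn v in jv vj.
have Pj : Pz j x.
  move: jv vj; rewrite /v ler_pdivlMr// ltr_pdivrMr// => jv vj.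
  split=> //; rewrite /node -mulr_natl.
    rewrite ler_pdivrMr//; move: jv; lra.
  by rewrite ler_pdivlMr//; move: vj; lra.
have jJ : (j < J.+4)%N.
  rewrite -(ltr_nat R); apply: le_lt_trans jv _.
  have ml0 : 0 <= m * l / pi by rewrite divr_ge0 ?mulr_ge0// ltW.
  have /andP[_] := Num.Theory.truncn_itv ml0; rewrite -/J => HJ.
  (* The phase contributes at most 1 and the offset of the nodes 3/2; rounding up gives the [J.+4]
     intervals. *)
  have : v <= m * l / pi + 5 / 2.
    have -> : m * l / pi + 5 / 2 = (m * l + 5 / 2 * pi) / pi by rewrite [RHS]mulrDl (mulfK pi_neq0).
    rewrite ler_pM2r ?invr_gt0//.
    have /andP[_ xl'] := xl; have : m * x <= m * l by rewrite ler_pM2l.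
    move: ph1; lra.
  have -> : J.+4%:R = J.+1%:R + 3 :> R by rewrite -(natrD R J.+1 3) addn3.
  move: HJ; lra.
suff xE : xget 0 [set x | Pz j x] = x.
  by apply/mapP; exists j; rewrite ?xE// mem_iota.
have /= [/andP[y0 yl] fy jy yj] := @xgetPex _ 0 _ (ex_intro [set x | Pz j x] x Pj).
case: Pj => [/andP[x0 x1]] _ jx xj.
set y := xget _ _ in y0 yl fy jy yj *; case: (ltgtP y x) => // xy; exfalso.
  exact: (one_zero m0 A0 cl fp y0 xy x1 fy fx jy xj).
exact: (one_zero m0 A0 cl fp x0 xy yl fx fy jx yj).
Qed.

Lemma sine_close_zeros_ge l m A ph f p : 0 < l -> 0 < m -> 0 < A ->
  - pi <= ph <= pi -> sine_close l m A ph f p -> AC 0 l f p ->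
  alternates (Num.truncn (m * l / pi) - 4) l f.
Proof.
move=> l0 m0 A0 /andP[ph0 ph1] cl fp; set J := Num.truncn _.
have m_neq0 : m != 0 by rewrite gt_eqF.
have pi0 := pi_gt0 R; have pi_neq0 : (pi : R) != 0 by rewrite gt_eqF.
have ml0 : 0 <= m * l / pi by rewrite divr_ge0 ?mulr_ge0// ltW.
have /andP[HJ _] := Num.Theory.truncn_itv ml0; rewrite -/J in HJ.
have node_gt0 j : (2 < j)%N -> 0 < node m ph j.
  move=> j2; rewrite /node divr_gt0//.
  have : (pi : R) * 3 <= pi *+ j by rewrite -[leRHS]mulr_natr ler_pM2l// ler_nat.
  move: ph1 pi0; lra.
have node_lt j : (j <= J)%N -> node m ph j < l.
  move=> jJ; rewrite /node ltr_pdivrMr// mulrC.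
  have : pi *+ j <= m * l.
    by rewrite -mulr_natl -ler_pdivlMr// (le_trans _ HJ)// ler_nat.
  move: ph0 pi0; lra.
have nodeSlt j : node m ph j < node m ph j.+1 by rewrite nodeS// ltrDl divr_gt0.
have fnode j : (2 < j)%N -> (j <= J)%N -> sgj j * f (node m ph j) < 0.
  move=> j2 jJ.
  have xl : 0 <= node m ph j <= l by rewrite !ltW ?node_gt0 ?node_lt.
  have [+ _] := close_node j m_neq0 cl xl.
  rewrite subrr mulr0 sub0r sinN sin_pihalf ler_norml => /andP[_]; lra.
have sgS j : sgj j.+1 = - sgj j by rewrite /sgj exprS mulN1r.
have zero j : (2 < j)%N -> (j < J)%N ->
    exists z, [/\ node m ph j < z, z < node m ph j.+1 & f z = 0].
  move=> j2 jJ.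
  have h1 := fnode j j2 (ltnW jJ); have h2 := fnode j.+1 (ltnW j2) jJ.
  have cf : {within `[node m ph j, node m ph j.+1], continuous f}.
    by apply: within_sub (AC_cont fp); rewrite ltW ?node_gt0 ?node_lt.
  have [z] : exists2 z, z \in `[node m ph j, node m ph j.+1] & f z = 0.
    apply: IVT => //; first exact/ltW.
    rewrite ge_min le_max; move: h1 h2; rewrite sgS /sgj.
    have [->|->] : (-1) ^+ j.+1 = 1 :> R \/ (-1) ^+ j.+1 = -1 :> R.
      by rewrite -signr_odd; case: odd; [right|left].
      rewrite mul1r mulN1r oppr_lt0 => /ltW k1 /ltW k2.
      by rewrite k1 k2 orbT.
    rewrite mulN1r opprK mul1r oppr_lt0 => /ltW k1 /ltW k2.
    by rewrite k1 k2 orbT.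
  rewrite in_itv/= => /andP[]; rewrite le_eqVlt => /predU1P[<-|jz].
    by move=> _ E; move: h1; rewrite E mulr0 ltxx.
  rewrite le_eqVlt => /predU1P[->|zj].
    by move=> E; move: h2; rewrite E mulr0 ltxx.
  by move=> fz; exists z.
(* Node 3 is the first that is positive for every phase, and node [J] is still below [l]. Between
   consecutive nodes there is a sign change, hence a zero, and node [j.+4] separates the zeros [a j]
   and [a j.+1], so that it serves as [t j]. *)
pose a j := xget 0 [set z | [/\ node m ph j.+3 < z, z < node m ph j.+4 & f z = 0]].
exists a, (fun j => node m ph j.+4) => j jn.
have jJ : (j.+4 < J)%N by move: jn; rewrite ltn_subRL !addSn add0n.
have /= [z1 z2 z3] := xgetPex 0 (zero j.+3 isT (ltnW jJ)).
have /= [w1 w2 w3] := xgetPex 0 (zero j.+4 isT jJ).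
split=> //.
- exact: lt_trans (node_gt0 _ _) z1.
- exact: lt_trans w2 (node_lt _ jJ).
split=> //; apply/eqP => E.
by have := fnode j.+4 isT (ltnW jJ); rewrite E mulr0 ltxx.
Qed.

End zeros.

(** * Min-max *)

Section min_max.
Context {R : realType} (V : lmodType R).
Variables (W : V -> Prop) (a d : V -> V -> R) (lam : nat -> R) (psi : nat -> V).
Implicit Types (u v w f : V) (c k : R).

(** Linearity is asked on [W] only, because the integrals are additive only where the integrands are
    integrable. *)
Definition bilinear_sym_on (b : V -> V -> R) :=
  (forall k u v w, W u -> W v -> W w -> b (k *: u + v) w = k * b u w + b v w) /\
  (forall u v, W u -> W v -> b u v = b v u).

Definition subspace_pred := W 0 /\ forall k u v, W u -> W v -> W (k *: u + v).

Hypotheses (W_sub : subspace_pred) (a_bil : bilinear_sym_on a)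
  (d_bil : bilinear_sym_on d).

Lemma subspaceD u v : W u -> W v -> W (u + v).
Proof. by move=> Wu Wv; rewrite -[u]scale1r; apply: W_sub.2. Qed.

Lemma subspaceZ k u : W u -> W (k *: u).
Proof. by move=> Wu; rewrite -[_ *: _]addr0; apply: W_sub.2 => //; exact: W_sub.1. Qed.

Lemma subspace_sum (I : Type) (s : seq I) (P : pred I) (F : I -> V) :
  (forall i, P i -> W (F i)) -> W (\sum_(i <- s | P i) F i).
Proof. by move=> WF; apply: big_ind => //; [exact: W_sub.1|exact: subspaceD]. Qed.

Section bilinear.
Variable b : V -> V -> R.
Hypothesis b_bil : bilinear_sym_on b.

Lemma bilDl u v w : W u -> W v -> W w -> b (u + v) w = b u w + b v w.
Proof. by move=> *; rewrite -{1}[u]scale1r b_bil.1// mul1r. Qed.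

Lemma bil0l w : W w -> b 0 w = 0.
Proof.
move=> Ww; have := b_bil.1 1 0 0 w W_sub.1 W_sub.1 Ww.
by rewrite scale1r addr0 mul1r => /eqP; rewrite -subr_eq0 opprD addNKr oppr_eq0 => /eqP.
Qed.

Lemma bilZl k u w : W u -> W w -> b (k *: u) w = k * b u w.
Proof.
by move=> *; rewrite -[_ *: _]addr0 b_bil.1 ?bil0l ?addr0//; exact: W_sub.1.
Qed.

Lemma bil_suml (I : Type) (s : seq I) (P : pred I) (F : I -> V) w :
  (forall i, P i -> W (F i)) -> W w ->
  b (\sum_(i <- s | P i) F i) w = \sum_(i <- s | P i) b (F i) w.
Proof.
move=> WF Ww; elim: s => [|i s IH]; first by rewrite !big_nil bil0l.
rewrite !big_cons; case: ifP => Pi //; rewrite bilDl ?IH//; first exact: WF.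
exact: subspace_sum.
Qed.

Lemma bilDr u v w : W u -> W v -> W w -> b w (u + v) = b w u + b w v.
Proof.
move=> Wu Wv Ww; rewrite b_bil.2// ?bilDl//; last exact: subspaceD.
by rewrite (b_bil.2 u)// (b_bil.2 v).
Qed.

Lemma bilZr k u w : W u -> W w -> b w (k *: u) = k * b w u.
Proof. by move=> *; rewrite b_bil.2 ?bilZl// ?(b_bil.2 u)//; exact: subspaceZ. Qed.

Lemma bil_sumr (I : Type) (s : seq I) (P : pred I) (F : I -> V) w :
  (forall i, P i -> W (F i)) -> W w ->
  b w (\sum_(i <- s | P i) F i) = \sum_(i <- s | P i) b w (F i).
Proof.
move=> WF Ww; rewrite b_bil.2 ?bil_suml//; last exact: subspace_sum.
by apply: eq_bigr => i Pi; rewrite b_bil.2//; exact: WF.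
Qed.

End bilinear.

(** The dimension count behind both halves of min-max: eigenfunctions are combined so as to satisfy
    given linear conditions, and test functions so as to be orthogonal to given eigenfunctions. *)
Lemma underdetermined_system (n p : nat) (M : 'I_n -> 'I_p -> R) : (p < n)%N ->
  exists2 c : 'I_n -> R, 0 < \sum_i c i ^+ 2 & forall j, \sum_i c i * M i j = 0.
Proof.
move=> pn; pose A := \matrix_(i < n, j < p) M i j.
have : kermx A != 0.
  by rewrite -mxrank_eq0 mxrank_ker subn_eq0 -ltnNge (leq_ltn_trans (rank_leq_col A)).
move=> /rowV0Pn[v /sub_kermxP vA v0].
exists (fun i => v 0 i).
  rewrite lt0r sumr_ge0 ?andbT; last by move=> i _; exact: sqr_ge0.
  apply: contra v0 => /eqP H; apply/eqP/rowP => i; rewrite mxE.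
  apply/eqP; rewrite -sqrf_eq0.
  by move: H => /psumr_eq0P -> // j _; exact: sqr_ge0.
move=> j; have := congr1 (fun X : 'rV[R]_p => X 0 j) vA; rewrite !mxE => vA0; rewrite -[RHS]vA0.
by apply: eq_bigr => i _; rewrite mxE.
Qed.

Hypotheses (W_psi : forall n, W (psi n))
  (psi_eigen : forall n w, W w -> a (psi n) w = lam n * d (psi n) w)
  (psi_orth : forall m n, d (psi m) (psi n) = (m == n)%:R)
  (lam_homo : {homo lam : m n / (m <= n)%N >-> m <= n}).

(** Numbering starts at 0, so [psi 0], ..., [psi m] span a space of dimension m + 1, on which the
    form is at most [lam m] times the norm; up to [m] conditions leave a nonzero vector. *)
Lemma max_on_span (m p : nat) (L : 'I_p -> V -> R) : (p <= m)%N ->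
  (forall i k u v, L i (k *: u + v) = k * L i u + L i v) ->
  exists f, [/\ W f, 0 < d f f, forall i, L i f = 0 & a f f <= lam m * d f f].
Proof.
move=> pm Llin; have [c c0 Hc] := underdetermined_system (fun (i : 'I_m.+1) j => L j (psi i)) pm.
pose f := \sum_(i < m.+1) c i *: psi i.
have Wc (i : 'I_m.+1) : W (c i *: psi i) by exact: subspaceZ.
have Wf : W f by apply: subspace_sum.
have dfk (k : 'I_m.+1) : d f (psi k) = c k.
  rewrite /f (bil_suml d_bil)// (bigD1 k)//= (bilZl d_bil)// psi_orth eqxx mulr1.
  rewrite big1 ?addr0// => i ik; rewrite (bilZl d_bil)// psi_orth.
  by rewrite [(_ == _)%N](negbTE ik) mulr0.
have dff : d f f = \sum_(i < m.+1) c i ^+ 2.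
  rewrite {2}/f (bil_sumr d_bil)//; apply: eq_bigr => i _.
  by rewrite (bilZr d_bil)// dfk expr2.
exists f; split => //; first by rewrite dff.
  move=> j; rewrite -[RHS](Hc j) /f.
  have L0 : L j 0 = 0.
    have := Llin j 1 0 0; rewrite scale1r addr0 mul1r => /eqP.
    by rewrite -subr_eq0 opprD addNKr oppr_eq0 => /eqP.
  elim/big_rec2: _ => // i y z _ <-; exact: Llin.
rewrite dff mulr_sumr {1}/f (bil_suml a_bil)//; apply: ler_sum => i _.
rewrite (bilZl a_bil)// psi_eigen// (d_bil.2 (psi i))// dfk mulrCA -expr2.
by rewrite ler_wpM2r ?sqr_ge0// lam_homo// -ltnS.
Qed.

Variable C : R.
Hypothesis a_bounded : forall f, W f -> - (C * d f f) <= a f f.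
Hypothesis psi_complete : forall f, W f ->
  (fun N => let r := f - \sum_(k < N) d f (psi k) *: psi k in d r r) @ \oo --> (0 : R).

(** Completeness is known in L2 only, so the form of the remainder [r N] is not known to tend to 0.
    The lower bound by [- C] times its L2 norm is enough, since the cross terms vanish and only an
    inequality is wanted. *)
Lemma min_on_complement (m : nat) f : W f ->
  (forall k : nat, (k < m)%N -> d f (psi k) = 0) -> lam m * d f f <= a f f.
Proof.
move=> Wf orth; pose S N := \sum_(k < N) d f (psi k) *: psi k.
pose r N := f - S N; pose rr N := d (r N) (r N).
have WS N : W (S N) by apply: subspace_sum => i _; exact: subspaceZ.
have Wr N : W (r N).
  by apply: subspaceD => //; rewrite -scaleN1r; exact: subspaceZ.
have dSk N u : W u -> d (S N) u = \sum_(k < N) d f (psi k) * d (psi k) u.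
  move=> Wu; rewrite /S (bil_suml d_bil)//; last by move=> i _; exact: subspaceZ.
  by apply: eq_bigr => i _; rewrite (bilZl d_bil).
have drk N (k : 'I_N) : d (r N) (psi k) = 0.
  rewrite /r (bilDl d_bil) ?subspaceZ//; last by rewrite -scaleN1r; exact: subspaceZ.
  rewrite -scaleN1r (bilZl d_bil)// mulN1r dSk// (bigD1 k)//= psi_orth eqxx mulr1.
  rewrite big1 ?addr0 ?subrr// => i ik.
  by rewrite psi_orth [(_ == _)%N](negbTE ik) mulr0.
have fE N : f = S N + r N by rewrite /r addrC subrK.
have aSk N u : W u ->
    a (S N) u = \sum_(k < N) d f (psi k) * (lam k * d (psi k) u).
  move=> Wu; rewrite /S (bil_suml a_bil)//; last by move=> i _; exact: subspaceZ.
  by apply: eq_bigr => i _; rewrite (bilZl a_bil)// psi_eigen.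
have aSr N : a (S N) (r N) = 0.
  by rewrite aSk// big1// => i _; rewrite (d_bil.2 (psi i))// drk !mulr0.
have dSr N : d (S N) (r N) = 0.
  by rewrite dSk// big1// => i _; rewrite (d_bil.2 (psi i))// drk mulr0.
have expand (b : V -> V -> R) N : bilinear_sym_on b -> b (S N) (r N) = 0 ->
    b f f = b (S N) (S N) + b (r N) (r N).
  move=> bb b0; have WSr : W (S N + r N) by exact: subspaceD.
  rewrite {1 2}(fE N) (bilDl bb (WS N) (Wr N) WSr).
  rewrite (bilDr bb (WS N) (Wr N) (WS N)) (bilDr bb (WS N) (Wr N) (Wr N)).
  by rewrite (bb.2 (r N) (S N))// b0 addr0 add0r.
have dfS N (k : 'I_N) : d (psi k) (S N) = d f (psi k).
  have := drk N k; rewrite /r (bilDl d_bil)//; last by rewrite -scaleN1r; exact: subspaceZ.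
  rewrite -scaleN1r (bilZl d_bil)// mulN1r => /eqP; rewrite subr_eq0 => /eqP ->.
  exact: d_bil.2.
have aSS N : lam m * d (S N) (S N) <= a (S N) (S N).
  rewrite dSk// aSk// mulr_sumr; apply: ler_sum => k _; rewrite dfS.
  have [km|mk] := ltnP k m; first by rewrite orth// !mul0r mulr0.
  rewrite [leRHS]mulrCA -expr2.
  by rewrite ler_wpM2r ?sqr_ge0// lam_homo.
have bound N : lam m * d f f - (C + lam m) * rr N <= a f f.
  rewrite (expand a N)// (expand d N)//.
  by have := aSS N; have := a_bounded (Wr N); rewrite -/(rr N); lra.
have cv : (fun N => lam m * d f f - (C + lam m) * rr N) @ \oo --> lam m * d f f.
  rewrite -[X in _ --> X]subr0 -[X in _ - X](mulr0 (C + lam m)).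
  apply: cvgB; first exact: cvg_cst.
  by apply: cvgM; [exact: cvg_cst|exact: psi_complete].
rewrite -(cvg_lim (@Rhausdorff R) cv); apply: limr_le; first by apply: cvgP cv.
by near=> N; exact: bound.
Unshelve. all: by end_near.
Qed.

(** Only the coefficients are known to be nonzero here; that the combination itself does not vanish
    will come from disjoint supports. *)
Lemma test_space_bound (m M : nat) (b : 'I_M -> V) : (m < M)%N ->
  (forall i, W (b i)) ->
  exists2 c : 'I_M -> R, 0 < \sum_i c i ^+ 2 &
    let f := \sum_i c i *: b i in lam m * d f f <= a f f.
Proof.
move=> mM Wb; have [c c0 Hc] := underdetermined_system (fun i (k : 'I_m) => d (b i) (psi k)) mM.
exists c => //=; apply: min_on_complement.
  by apply: subspace_sum => i _; exact: subspaceZ.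
move=> k km; rewrite (bil_suml d_bil)//; last by move=> i _; exact: subspaceZ.
rewrite -[RHS](Hc (Ordinal km)); apply: eq_bigr => i _.
by rewrite (bilZl d_bil).
Qed.

End min_max.

(** * One-dimensional inequalities and test functions *)

Section edge_inequalities.
Context {R : realType}.
Notation mu := (@lebesgue_measure R).
Implicit Types (a b c d x y z k l : R) (f g h : R -> R).

Lemma AC_sqr a b f g : AC a b f g ->
  AC a b (fun x => f x ^+ 2) (fun x => 2 * (f x * g x)).
Proof.
by move=> fg; apply: AC_eq (AC_mul fg fg) => x _; [rewrite expr2|ring].
Qed.

Lemma AC_L2 a b f g : AC a b f g -> L2 a b f.
Proof. by move=> fg; exact/L2_cont/AC_cont/fg. Qed.

(** The increment of [f ^+ 2] is the integral of 2 f g, at most that of dl g^2 + f^2 / dl. Averaging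
    over the starting point in [[0, l]] replaces the unknown initial value by the mean of [f ^+ 2],
    whence the term in [l^-1]. *)
Lemma sup_sqr_le l f g dl x : 0 < l -> 0 < dl -> AC 0 l f g -> L2 0 l g ->
  0 <= x <= l ->
  f x ^+ 2 <= dl * intg 0 l (fun x => g x ^+ 2) +
    (dl^-1 + l^-1) * intg 0 l (fun x => f x ^+ 2).
Proof.
move=> l0 d0 fg g2 /andP[x0 xl].
have f2 := AC_L2 fg; have ff := AC_sqr fg.
set Ig := intg 0 l (fun x => g x ^+ 2); set If := intg 0 l (fun x => f x ^+ 2).
pose K := dl * Ig + dl^-1 * If.
pose v x := dl * g x ^+ 2 + dl^-1 * f x ^+ 2.
have lv : L1 0 l v by apply: L1D; apply: L1Z; [exact: g2.2|exact: f2.2].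
have vE : intg 0 l v = K.
  have [_ lg] := g2; have [_ lf] := f2.
  by rewrite intgD ?intgZ//; exact: L1Z.
have v0 t : 0 <= v t by rewrite addr_ge0// mulr_ge0 ?invr_ge0 ?sqr_ge0// ltW.
have fgv t : `|2 * (f t * g t)| <= v t.
  have dd : dl * dl^-1 = 1 by rewrite divff// gt_eqF.
  have E : v t - 2 * (f t * g t) = dl * (g t - dl^-1 * f t) ^+ 2.
    have -> : dl * (g t - dl^-1 * f t) ^+ 2 = dl * g t ^+ 2 -
      2 * (dl * dl^-1) * (f t * g t) + (dl * dl^-1) * dl^-1 * f t ^+ 2 by ring.
    by rewrite dd /v; ring.
  have E' : v t + 2 * (f t * g t) = dl * (g t + dl^-1 * f t) ^+ 2.
    have -> : dl * (g t + dl^-1 * f t) ^+ 2 = dl * g t ^+ 2 +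
      2 * (dl * dl^-1) * (f t * g t) + (dl * dl^-1) * dl^-1 * f t ^+ 2 by ring.
    by rewrite dd /v; ring.
  have p1 : 0 <= v t - 2 * (f t * g t) by rewrite E mulr_ge0 ?sqr_ge0// ltW.
  have p2 : 0 <= v t + 2 * (f t * g t) by rewrite E' mulr_ge0 ?sqr_ge0// ltW.
  by rewrite ler_norml; apply/andP; split; lra.
have sub y z : 0 <= y -> y <= z -> z <= l -> `|f z ^+ 2 - f y ^+ 2| <= K.
  move=> y0 yz zl; rewrite (AC_intg ff)//.
  have ly : L1 y z (fun t => 2 * (f t * g t)) by exact: L1_sub (AC_L1 ff).
  apply: le_trans (intg_norm ly) _; apply: (@le_trans _ _ (intg y z v)).
    by apply: intg_le => //; [exact: L1_norm|exact: L1_sub lv].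
  rewrite -vE (@intg_chasles _ 0 y l)//; last exact: le_trans zl.
  rewrite (@intg_chasles _ y z l)//; last exact: L1_sub lv.
  by have := @intg_ge0 _ 0 y v (fun t _ => v0 t); have := @intg_ge0 _ z l v (fun t _ => v0 t); lra.
have : intg 0 l (fun=> f x ^+ 2) <= intg 0 l (fun y => f y ^+ 2 + K).
  apply: intg_le; [exact: L1_cst|apply: L1D; [exact: f2.2|exact: L1_cst]|].
  move=> y /andP[y0 yl]; have [yx|/ltW xy] := leP y x.
    by have := sub y x y0 yx xl; rewrite ler_norml => /andP[_]; lra.
  by have := sub x y x0 xy yl; rewrite ler_norml => /andP[+ _]; lra.
have [_ lf] := f2; rewrite intgD ?intg_cst ?subr0 ?(ltW l0)//; last exact: L1_cst.
rewrite -/If -ler_pdivlMr// => H; apply: (le_trans H); rewrite le_eqVlt; apply/orP; left.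
by apply/eqP; rewrite /K; field; rewrite !gt_eqF.
Qed.

(* Jacobi's trick: T = k tan(k (c - x)) solves T' = - k^2 - T^2, so that
   g^2 - k^2 f^2 = (g - T f)^2 + (T f^2)'. *)
Lemma wirtinger_half a b c k f g : a <= b -> 0 < k -> k * (b - a) < pi / 2 ->
  (c = a /\ f b = 0) \/ (c = b /\ f a = 0) ->
  AC a b f g -> L2 a b g ->
  k ^+ 2 * intg a b (fun x => f x ^+ 2) <= intg a b (fun x => g x ^+ 2).
Proof.
move=> ab k0 kab cP fg g2; have f2 := AC_L2 fg.
pose T x := k * tan (k * (c - x)).
have cpos x : a <= x <= b -> 0 < cos (k * (c - x)).
  move=> /andP[ax xb]; apply: cos_gt0_pihalf; rewrite -ltr_norml normrM gtr0_norm//.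
  apply: le_lt_trans kab; rewrite ler_pM2l// ler_norml.
  by case: cP => -[-> _]; apply/andP; split; lra.
have dT x : a <= x <= b -> is_derive x 1 T (- (k ^+ 2) - T x ^+ 2).
  move=> xab; have cx : cos (k * (c - x)) != 0 by rewrite gt_eqF// cpos.
  have H : is_derive x 1 (fun x => k * (c - x) : R) (- k).
    by apply: is_derive_eq; rewrite /GRing.scale/=; ring.
  have D1 := @is_derive1_comp _ tan (fun x => k * (c - x)) x _ _ (is_derive_tan cx) H.
  have := is_deriveZ k D1.
  suff -> : k *: (cos (k * (c - x)) ^- 2 * - k) = - (k ^+ 2) - T x ^+ 2 by exact.
  rewrite cos2_tan2// /T /GRing.scale/=; ring.
have cT x : a <= x <= b -> {for x, continuous T}.
  move=> xab; apply/differentiable_continuous/derivable1_diffP.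
  by have [] := dT x xab.
have cwT : {within `[a, b], continuous T}.
  apply: continuous_in_subspaceT => x /set_mem; rewrite /= in_itv/=; exact: cT.
have TAC : AC a b T (fun x => - (k ^+ 2) - T x ^+ 2).
  apply: AC_C1 => // x; apply: cvgB; first exact: cvg_cst.
  by apply: cvgM; exact: cwT.
have TfAC := AC_mul TAC (AC_sqr fg).
have := AC_intg TfAC (lexx a) ab (lexx b).
(* At [c] the tangent vanishes, at the other end [f] does. So no condition on [f] is needed at
   [c]. *)
have -> : T b * f b ^+ 2 - T a * f a ^+ 2 = 0.
  by case: cP => -[cE f0]; rewrite f0 /T cE subrr mulr0 tan0; ring.
move=> E.
have Tf2 : L2 a b (fun x => T x * f x).
  apply: L2_cont => x; apply: cvgM; [exact: cwT|exact: AC_cont fg x].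
have gT2 := L2B g2 Tf2.
have : intg a b (fun x => (g x - T x * f x) ^+ 2) + 0 =
  intg a b (fun x => g x ^+ 2 - k ^+ 2 * f x ^+ 2).
  rewrite E -intgD; [|exact: gT2.2|exact: AC_L1 TfAC].
  by apply: intg_eq => x _; ring.
rewrite addr0 intgB ?intgZ; [|exact: f2.2|exact: g2.2|apply: L1Z; exact: f2.2].
have := @intg_ge0 _ a b (fun x => (g x - T x * f x) ^+ 2) (fun x _ => sqr_ge0 _).
by move=> ? ?; lra.
Qed.

(** A midpoint cuts its cell into two halves, each with a zero of [f] at one end and a free end at
    the other. This costs one condition per cell and none at the ends of the edge. *)
Lemma wirtinger_midpoints l k (m : nat) f g : 0 < l -> 0 < k -> (0 < m)%N ->
  k * l / pi < m%:R -> AC 0 l f g -> L2 0 l g ->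
  (forall i, (i < m)%N -> f ((i%:R + 1 / 2) * (l / m%:R)) = 0) ->
  k ^+ 2 * intg 0 l (fun x => f x ^+ 2) <= intg 0 l (fun x => g x ^+ 2).
Proof.
move=> l0 k0 m0 klm fg g2 fm; have f2 := AC_L2 fg.
have mR : 0 < m%:R :> R by rewrite ltr0n.
pose h := l / m%:R; have h0 : 0 < h by rewrite divr_gt0.
have mh : m%:R * h = l by rewrite mulrC divfK ?gt_eqF.
have kh : k * (h / 2) < pi / 2.
  rewrite mulrA ltr_pM2r ?invr_gt0// /h mulrA ltr_pdivrMr//.
  by move: klm; rewrite ltr_pdivrMr ?pi_gt0// (mulrC _ pi).
have H (i : nat) : (i <= m)%N -> k ^+ 2 * intg 0 (i%:R * h) (fun x => f x ^+ 2) <=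
    intg 0 (i%:R * h) (fun x => g x ^+ 2).
  elim: i => [_|i IH im]; first by rewrite mul0r !intgxx mulr0.
  have i0 : 0 <= i%:R * h by rewrite mulr_ge0// ltW.
  have il : i.+1%:R * h <= l by rewrite -mh ler_pM2r// ler_nat.
  have e1 : (i%:R + 1 / 2) * h = i%:R * h + h / 2 by ring.
  have e2 : i.+1%:R * h = i%:R * h + h / 2 + h / 2 by rewrite -natr1; field.
  have fi : f (i%:R * h + h / 2) = 0 by rewrite -e1; exact: fm.
  rewrite e2 in il *; set s := i%:R * h in i0 il fi IH *; have {}IH := IH (ltnW im).
  have split_int (u : R -> R) : L1 0 l u -> intg 0 (s + h / 2 + h / 2) u =
      intg 0 s u + (intg s (s + h / 2) u + intg (s + h / 2) (s + h / 2 + h / 2) u).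
    move=> lu; rewrite (@intg_chasles _ 0 s)//; last exact: L1_sub lu.
      rewrite (@intg_chasles _ s (s + h / 2))//; first by lra.
        by lra.
      by apply: L1_sub lu.
    by lra.
  rewrite !split_int; [|exact: g2.2|exact: f2.2].
  rewrite !mulrDr; apply: lerD => //; apply: lerD.
    apply: (@wirtinger_half _ _ s); rewrite ?lerDl//; first lra.
    - by rewrite addrAC subrr add0r.
    - by left.
    - apply: AC_sub fg; lra.
    - apply: L2_sub g2; lra.
  apply: (@wirtinger_half _ _ (s + h / 2 + h / 2)) => //; first lra.
  - by rewrite addrAC subrr add0r.
  - by right.
  - apply: AC_sub fg; lra.
  - apply: L2_sub g2; lra.
by have := H m (leqnn m); rewrite mh.
Qed.

Lemma AC_extend0 a b l f g : 0 <= a -> a <= b -> b <= l -> AC a b f g ->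
  f a = 0 -> f b = 0 ->
  AC 0 l (f \_ `]a, b[) (g \_ `]a, b[).
Proof.
move=> a0 ab bl fg fa fb; have lg := AC_L1 fg.
have lO : mu.-integrable `]a, b[ (EFin \o g).
  by apply: integrableS lg => //; exact: subset_itv_oo_cc.
split.
  rewrite /L1 -restrict_EFin; apply/integrable_restrict => //=.
  apply: integrableS lO => //; exact: measurableI.
move=> x /andP[x0 xl]; rewrite [X in _ = X + _]patchE memNset ?add0r; last first.
  by rewrite /= in_itv/= ltNge a0.
rewrite /intg -Rintegral_mkcondr.
have [xa|ax] := leP x a.
  rewrite patchE memNset; last by rewrite /= in_itv/= ltNge xa.
  rewrite (_ : _ `&` _ = set0) ?Rintegral_set0//.
  rewrite -subset0 => y [/=]; rewrite !in_itv/= => /andP[_ yx].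
  by move=> /andP[/(le_lt_trans xa)/lt_le_trans/(_ yx)]; rewrite ltxx.
have [xb|bx] := ltP x b.
  rewrite patchE mem_set ?in_itv/= ?ax ?xb//; last by rewrite /= in_itv/= ax.
  rewrite (_ : _ `&` _ = `]a, x]%classic); last first.
    apply/seteqP; split => y /=; rewrite !in_itv/=.
      by move=> [/andP[_ ->] /andP[->]].
    move=> /andP[ay yx]; rewrite yx ay (le_lt_trans yx xb) (ltW (le_lt_trans a0 ay)).
    by [].
  rewrite Rintegral_itv_obnd_cbnd.
    have := AC_intg fg (lexx a) (ltW ax) (ltW xb); rewrite fa subr0; exact.
  apply: integrableS lg => // y /=; rewrite !in_itv/= => /andP[/ltW -> yx] /=.
  by rewrite (le_trans yx) ?ltW.
rewrite patchE memNset; last by rewrite /= in_itv/= [x < b]ltNge bx andbF.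
rewrite (_ : _ `&` _ = `]a, b[%classic); last first.
  apply/seteqP; split => y /=; rewrite !in_itv/=; first by case.
  by move=> /andP[ay yb]; rewrite ay yb (ltW (le_lt_trans a0 ay)) (le_trans (ltW yb) bx).
rewrite Rintegral_itv_bndo_bndc// Rintegral_itv_obnd_cbnd; last first.
  apply: integrableS lg => // y /=; rewrite !in_itv/= => /andP[/ltW -> ->] //.
by have := AC_intg fg (lexx a) ab (lexx b); rewrite fa fb subr0.
Qed.

Lemma L2_extend0 a b l g : 0 <= a -> b <= l -> L2 a b g -> L2 0 l (g \_ `]a, b[).
Proof.
move=> a0 bl g2.
have key h : L1 a b h -> L1 0 l (h \_ `]a, b[).
  move=> lh; rewrite /L1 -restrict_EFin; apply/integrable_restrict => //=.
  apply: integrableS lh => //; first exact: measurableI.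
  by move=> x [_]; exact: subset_itv_oo_cc.
split; first exact: L1_measurable (key _ (L2_L1 g2)).
apply: L1_eq (key _ g2.2) => x _; rewrite !patchE; case: ifP => // _.
by rewrite expr0n.
Qed.

Lemma intg_extend0 a b l h : 0 <= a -> b <= l -> L1 a b h ->
  intg 0 l (h \_ `]a, b[) = intg a b h.
Proof.
move=> a0 bl lh; rewrite /intg -Rintegral_mkcondr.
rewrite (_ : _ `&` _ = `]a, b[%classic).
  rewrite Rintegral_itv_bndo_bndc; last first.
    by apply: integrableS lh => //; exact: subset_itv_oo_cc.
  rewrite Rintegral_itv_obnd_cbnd//.
  by apply: integrableS lh => //; exact: subset_itv_oc_cc.
apply/seteqP; split => y /=; rewrite !in_itv/=; first by case.
by move=> /andP[ay yb]; rewrite ay yb (ltW (le_lt_trans a0 ay)) (le_trans (ltW yb) bl).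
Qed.

Definition bump_itv k (j : nat) : set R := `]j%:R * (pi / k), j.+1%:R * (pi / k)[%classic.
Definition bump k j : R -> R := (fun x => sin (k * x)) \_ (bump_itv k j).
Definition dbump k j : R -> R := (fun x => k * cos (k * x)) \_ (bump_itv k j).

Lemma bumpP l k j : 0 < k -> j.+1%:R * (pi / k) <= l ->
  [/\ AC 0 l (bump k j) (dbump k j), L2 0 l (dbump k j),
    bump k j 0 = 0, bump k j l = 0 &
    0 < intg 0 l (fun x => bump k j x ^+ 2) /\
    intg 0 l (fun x => dbump k j x ^+ 2) = k ^+ 2 * intg 0 l (fun x => bump k j x ^+ 2)].
Proof.
move=> k0 jl; set a := j%:R * (pi / k); set b := j.+1%:R * (pi / k) in jl.
have pk0 : 0 < pi / k by rewrite divr_gt0 ?pi_gt0.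
have a0 : 0 <= a by rewrite mulr_ge0// ltW.
have bE : b = a + pi / k by rewrite /b -natr1 mulrDl mul1r.
have ab : a < b by rewrite bE ltrDl.
have sinj n : sin (k * (n%:R * (pi / k))) = 0 :> R.
  rewrite (_ : k * (n%:R * (pi / k)) = 0 + pi *+ n); last first.
    by rewrite -mulr_natl; field; rewrite gt_eqF.
  by rewrite (alternatingn (@sinDpi R)) sin0 mulr0.
have sAC := AC_sin a b k.
have s2 := AC_L2 sAC.
have c2 : L2 a b (fun x => cos (k * x)).
  by apply: L2_cont; apply: continuous_within; exact: continuous_cos_lin.
have kc2 := L2Z k c2.
have sq (h : R -> R) : (fun x => (h \_ (bump_itv k j)) x ^+ 2) =
    (fun x => h x ^+ 2) \_ (bump_itv k j).
  by apply/funext => x; rewrite !patchE; case: ifP => // _; rewrite expr0n.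
(* The product of sine and cosine vanishes at both ends, so the integral of its derivative gives
   sin^2 and cos^2 the same mean on a half-period; hence the exact ratio [k ^+ 2]. *)
have scAC := AC_mul sAC (AC_cos a b k).
have E1 := AC_intg scAC (lexx a) (ltW ab) (lexx b).
rewrite !sinj !mul0r subrr in E1.
have E2 : intg a b (fun x => sin (k * x) ^+ 2) + intg a b (fun x => cos (k * x) ^+ 2) = pi / k.
  rewrite -intgD; [|exact: s2.2|exact: c2.2].
  rewrite (@intg_eq _ _ _ _ (fun=> 1)); last by move=> x _; rewrite addrC cos2Dsin2.
  by rewrite intg_cst ?(ltW ab)// mul1r bE addrAC subrr add0r.
have E3 : intg a b (fun x => sin (k * x) ^+ 2) = intg a b (fun x => cos (k * x) ^+ 2).
  have : 0 = k * (intg a b (fun x => cos (k * x) ^+ 2) - intg a b (fun x => sin (k * x) ^+ 2)).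
    rewrite E1 -intgB; [|exact: c2.2|exact: s2.2].
    rewrite -intgZ; last by apply: L1B; [exact: c2.2|exact: s2.2].
    by apply: intg_eq => x _; ring.
  move=> /esym/eqP; rewrite mulf_eq0 gt_eqF//= subr_eq0 => /eqP; exact: esym.
have b0 : bump k j 0 = 0.
  by rewrite /bump patchE memNset// /bump_itv /= in_itv/= ltNge a0.
split=> //.
- by apply: AC_extend0 => //; exact: ltW.
- exact: L2_extend0.
- by rewrite /bump patchE memNset// /bump_itv /= in_itv/= [l < _]ltNge jl andbF.
have [_ ls] := s2; have [_ lkc] := kc2.
rewrite /bump /dbump !sq !intg_extend0//.
split; first by move: E2 pk0; rewrite -E3; lra.
rewrite E3 -intgZ; last exact: c2.2.
by apply: intg_eq => x _; rewrite exprMn.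
Qed.

Lemma bump_itv_disj k i j x : 0 < k -> bump_itv k i x -> bump_itv k j x -> i = j.
Proof.
move=> k0; have pk0 : 0 < pi / k by rewrite divr_gt0 ?pi_gt0.
rewrite /bump_itv /= !in_itv/= => /andP[ix xi] /andP[jx xj].
have := lt_trans ix xj; rewrite ltr_pM2r// ltr_nat ltnS => ij.
have := lt_trans jx xi; rewrite ltr_pM2r// ltr_nat ltnS => ji.
by apply/eqP; rewrite eqn_leq ij.
Qed.

End edge_inequalities.

(** * The quadratic form on the graph *)

Section graph_form.
Context {R : realType} (G : metric_graph R).
Variables (q : edge G -> R -> R) (b : edge_end G -> edge_end G -> R).
Hypotheses (q_L1 : forall e, L1 0 (len e) (q e)) (b_sym : forall i j, b i j = b j i).

(* The second component stands for a weak derivative of the first, see [H1G]. *)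
Definition gpair : Type := ((edge G -> R -> R^o) * (edge G -> R -> R^o))%type.
HB.instance Definition _ := GRing.Lmodule.on gpair.

Implicit Types (u v w : gpair) (e : edge G) (i j : edge_end G).

Definition H1G u := forall e, AC 0 (len e) (u.1 e) (u.2 e) /\ L2 0 (len e) (u.2 e).

Definition edge_sum (h : gpair -> gpair -> edge G -> R -> R) u v : R :=
  \sum_e intg 0 (len e) (h u v e).

Definition dotG : gpair -> gpair -> R := edge_sum (fun u v e x => u.1 e x * v.1 e x).
Definition energyG : gpair -> gpair -> R := edge_sum (fun u v e x => u.2 e x * v.2 e x).
Definition potentialG : gpair -> gpair -> R :=
  edge_sum (fun u v e x => q e x * u.1 e x * v.1 e x).

Definition end_val (f : edge G -> R -> R) i : R := f i.1 (end_coord i).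

Definition boundaryG u v : R :=
  \sum_i \sum_j b i j * end_val u.1 j * end_val v.1 i.

Definition formG u v := energyG u v + potentialG u v + boundaryG u v.

Lemma pair1E k u v e x : (k *: u + v).1 e x = k * u.1 e x + v.1 e x.
Proof. by case: u v => [? ?] [? ?]. Qed.

Lemma pair2E k u v e x : (k *: u + v).2 e x = k * u.2 e x + v.2 e x.
Proof. by case: u v => [? ?] [? ?]. Qed.

Lemma H1G_subspace : subspace_pred H1G.
Proof.
split=> [e|k u v Hu Hv e].
  split; first exact: AC_cst.
  by apply: L2_cont; apply: continuous_within; exact: cst_continuous.
have [au lu] := Hu e; have [av lv] := Hv e; split.
  exact: ACD (ACZ k au) av.
exact: L2D (L2Z k lu) lv.
Qed.

Lemma edge_sum_bilinear (h : gpair -> gpair -> edge G -> R -> R) :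
  (forall u v e, H1G u -> H1G v -> L1 0 (len e) (h u v e)) ->
  (forall k u v w e x, h (k *: u + v) w e x = k * h u w e x + h v w e x) ->
  (forall u v e x, h u v e x = h v u e x) ->
  bilinear_sym_on H1G (edge_sum h).
Proof.
move=> hL hlin hsym; split=> [k u v w Hu Hv Hw|u v Hu Hv].
  rewrite /edge_sum mulr_sumr -big_split/=; apply: eq_bigr => e _.
  rewrite -intgZ; last exact: hL.
  rewrite -intgD; [|by apply: L1Z; exact: hL|exact: hL].
  by apply: intg_eq => x _; rewrite hlin.
by apply: eq_bigr => e _; apply: intg_eq => x _; rewrite hsym.
Qed.

Lemma dotG_bilinear : bilinear_sym_on H1G dotG.
Proof.
apply: edge_sum_bilinear => [u v e Hu Hv|k u v w e x|u v e x].
- by apply: L2_mul; apply: AC_L2; [exact: (Hu e).1|exact: (Hv e).1].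
- by rewrite pair1E; ring.
- by rewrite mulrC.
Qed.

Lemma energyG_bilinear : bilinear_sym_on H1G energyG.
Proof.
apply: edge_sum_bilinear => [u v e Hu Hv|k u v w e x|u v e x].
- by apply: L2_mul; [exact: (Hu e).2|exact: (Hv e).2].
- by rewrite pair2E; ring.
- by rewrite mulrC.
Qed.

Lemma potentialG_L1 u v e : H1G u -> H1G v ->
  L1 0 (len e) (fun x => q e x * u.1 e x * v.1 e x).
Proof.
by move=> Hu Hv; apply: L1_mul_cont; [apply: L1_mul_cont => //|];
  apply: AC_cont; [exact: (Hu e).1|exact: (Hv e).1].
Qed.

Lemma potentialG_bilinear : bilinear_sym_on H1G potentialG.
Proof.
apply: edge_sum_bilinear => [u v e Hu Hv|k u v w e x|u v e x].
- exact: potentialG_L1.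
- by rewrite pair1E; ring.
- by rewrite mulrAC.
Qed.

Lemma boundaryG_bilinear : bilinear_sym_on H1G boundaryG.
Proof.
split=> [k u v w _ _ _|u v _ _].
  rewrite /boundaryG mulr_sumr -big_split/=; apply: eq_bigr => i _.
  rewrite mulr_sumr -big_split/=; apply: eq_bigr => j _.
  have -> : end_val (k *: u.1 + v.1) j = k * end_val u.1 j + end_val v.1 j by [].
  ring.
rewrite /boundaryG exchange_big/=; apply: eq_bigr => i _; apply: eq_bigr => j _.
by rewrite b_sym; ring.
Qed.

Lemma formG_bilinear : bilinear_sym_on H1G formG.
Proof.
have [e1 e2] := energyG_bilinear; have [p1 p2] := potentialG_bilinear.
have [b1 b2] := boundaryG_bilinear.
split=> [k u v w Hu Hv Hw|u v Hu Hv]; rewrite /formG.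
  by rewrite e1// p1// b1//; ring.
by rewrite e2// p2// b2.
Qed.

(** Sums over all edges stand in for maxima, so that the same constants serve on every edge. *)
Definition inv_lenG : R := \sum_(e : edge G) (len e)^-1.
Definition coefG : R := \sum_(e : edge G) intg 0 (len e) (fun x => `|q e x|) +
  \sum_i \sum_j `|b i j|.

Lemma inv_lenG_ge0 : 0 <= inv_lenG.
Proof. by apply: sumr_ge0 => e _; rewrite invr_ge0 ltW ?len_gt0. Qed.

Lemma coefG_ge0 : 0 <= coefG.
Proof.
by apply: addr_ge0; apply: sumr_ge0 => e _; [exact: intg_ge0|exact: sumr_ge0].
Qed.

Lemma dotG_ge0 u : 0 <= dotG u u.
Proof. by apply: sumr_ge0 => e _; apply: intg_ge0 => x _; rewrite -expr2 sqr_ge0. Qed.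

Lemma energyG_ge0 u : 0 <= energyG u u.
Proof. by apply: sumr_ge0 => e _; apply: intg_ge0 => x _; rewrite -expr2 sqr_ge0. Qed.

Lemma sup_sqrG u dl e x : 0 < dl -> H1G u -> 0 <= x <= len e ->
  u.1 e x ^+ 2 <= dl * energyG u u + (dl^-1 + inv_lenG) * dotG u u.
Proof.
move=> d0 Hu xl; have [fg g2] := Hu e.
have := sup_sqr_le (len_gt0 e) d0 fg g2 xl => /le_trans; apply.
have le1 (h : gpair -> edge G -> R -> R) :
    intg 0 (len e) (fun x => h u e x ^+ 2) <=
    \sum_e0 intg 0 (len e0) (fun x => h u e0 x * h u e0 x).
  rewrite (bigD1 e)//= (@intg_eq _ _ _ _ (fun x => h u e x * h u e x)).
    rewrite lerDl sumr_ge0// => e0 _; apply: intg_ge0 => y _.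
    by rewrite -expr2 sqr_ge0.
  by move=> y _; rewrite expr2.
apply: lerD; first by rewrite ler_wpM2l ?(ltW d0)// (le1 (fun u => u.2)).
apply: ler_pM.
- by rewrite addr_ge0 ?invr_ge0 ?(ltW d0) ?(ltW (len_gt0 e)).
- by apply: intg_ge0 => y _; rewrite sqr_ge0.
- rewrite lerD2l /inv_lenG (bigD1 e)//= lerDl sumr_ge0// => e0 _.
  by rewrite invr_ge0 ltW ?len_gt0.
- exact: (le1 (fun u => u.1)).
Qed.

Lemma end_coord_in i : 0 <= end_coord i <= len i.1.
Proof.
by rewrite /end_coord; case: i.2; rewrite lexx ?andbT /= ltW ?len_gt0.
Qed.

(** Potential and boundary terms are both at most [coefG] times the supremum of u^2. The parameter
    [dl] stays free: a small constant gives semiboundedness, and 1 / k balances the two error terms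
    at frequency k. *)
Lemma formG_energy u dl : 0 < dl -> H1G u ->
  `|formG u u - energyG u u| <=
    coefG * (dl * energyG u u + (dl^-1 + inv_lenG) * dotG u u).
Proof.
move=> d0 Hu; set S := _ + _ * dotG u u.
have supS e x : 0 <= x <= len e -> u.1 e x ^+ 2 <= S by exact: sup_sqrG.
have -> : formG u u - energyG u u = potentialG u u + boundaryG u u.
  by rewrite /formG; ring.
apply: le_trans (ler_normD _ _) _; rewrite /coefG mulrDl; apply: lerD.
  apply: le_trans (ler_norm_sum _ _ _) _; rewrite mulr_suml; apply: ler_sum => e _.
  apply: le_trans (intg_norm (potentialG_L1 _ Hu Hu)) _.
  rewrite mulrC -intgZ; last exact: L1_norm.
  apply: intg_le; [exact: L1_norm (potentialG_L1 _ Hu Hu)|exact/L1Z/L1_norm|].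
  move=> x xl; rewrite -mulrA normrM mulrC ler_wpM2r// -expr2 ger0_norm ?sqr_ge0//.
  exact: supS.
apply: le_trans (ler_norm_sum _ _ _) _; rewrite mulr_suml; apply: ler_sum => i _.
apply: le_trans (ler_norm_sum _ _ _) _; rewrite mulr_suml; apply: ler_sum => j _.
rewrite -mulrA normrM ler_wpM2l// normrM.
have si := supS i.1 _ (end_coord_in i); have sj := supS j.1 _ (end_coord_in j).
have := sqr_ge0 (`|end_val u.1 j| - `|end_val u.1 i|).
move: si sj; rewrite -/(end_val u.1 i) -/(end_val u.1 j).
rewrite -(real_normK (num_real (end_val u.1 i))) -(real_normK (num_real (end_val u.1 j))).
nra.
Qed.

End graph_form.

(** * Weyl's law *)

Section weyl.
Context {R : realType} (G : metric_graph R).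
Variables (q : edge G -> R -> R) (b : edge_end G -> edge_end G -> R).
Hypotheses (q_L1 : forall e, L1 0 (len e) (q e)) (b_sym : forall i j, b i j = b j i).
(** Of the form domain it is only recorded that it is a subspace between the H^1 functions vanishing
    at all edge ends and all H^1 functions; Weyl's law thus comes out for all vertex conditions
    together. *)
Variables (W : gpair G -> Prop) (lam : nat -> R) (psi : nat -> gpair G).
Hypotheses (W_H1 : forall u, W u -> H1G u) (W_sub : subspace_pred W)
  (W_dirichlet : forall u, H1G u -> (forall i, end_val u.1 i = 0) -> W u)
  (W_psi : forall n, W (psi n))
  (psi_eigen : forall n w, W w -> formG q b (psi n) w = lam n * dotG (psi n) w)
  (psi_orth : forall m n, dotG (psi m) (psi n) = (m == n)%:R)
  (lam_homo : {homo lam : m n / (m <= n)%N >-> m <= n})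
  (psi_complete : forall f, W f -> (fun N =>
    let r := f - \sum_(k < N) dotG f (psi k) *: psi k in dotG r r) @ \oo --> (0 : R)).

Let a := formG q b.
Let d := @dotG R G.
Let C0 := coefG q b.
Let D := inv_lenG G.
Let C0_ge0 : 0 <= C0. Proof. exact: coefG_ge0. Qed.
Let D_ge0 : 0 <= D. Proof. exact: inv_lenG_ge0. Qed.

Let bil_W (h : gpair G -> gpair G -> R) :
  bilinear_sym_on (@H1G R G) h -> bilinear_sym_on W h.
Proof.
by move=> [h1 h2]; split=> *; [apply: h1|apply: h2]; exact: W_H1.
Qed.

Let a_bil : bilinear_sym_on W a. Proof. by apply: bil_W; exact: formG_bilinear. Qed.
Let d_bil : bilinear_sym_on W d. Proof. by apply: bil_W; exact: dotG_bilinear. Qed.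

(** A single vertex without edges is a metric graph, but its L2 space is zero and contains no
    orthonormal sequence. *)
Lemma card_edge_gt0 : (0 < #|edge G|)%N.
Proof.
rewrite lt0n; apply/negP => /eqP E0; have := psi_orth 0 0.
rewrite eqxx /dotG /edge_sum big1 => [/esym/eqP|e _]; first by rewrite oner_eq0.
by have := card0_eq E0 e; rewrite inE.
Qed.

Lemma total_len_gt0 : 0 < total_len G.
Proof.
have /card_gt0P[e _] := card_edge_gt0.
by rewrite /total_len (bigD1 e)//= ltr_wpDr ?len_gt0// sumr_ge0// => *; rewrite ltW ?len_gt0.
Qed.

Let a_semibounded f : W f -> - (C0 * (C0 + 1 + D) * d f f) <= a f f.
Proof.
move=> Wf; have c1 : 0 < C0 + 1 by rewrite ltr_wpDl.
(* With this parameter the error in the energy is at most the energy itself and is absorbed. *)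
have d0 : 0 < (C0 + 1)^-1 by rewrite invr_gt0.
have := formG_energy b q_L1 d0 (W_H1 Wf); rewrite invrK -/a -/d -/C0 -/D.
rewrite ler_norml => /andP[+ _].
have e0 := energyG_ge0 f; set E := energyG f f in e0 *.
have : C0 * ((C0 + 1)^-1 * E) <= E.
  rewrite mulrA -[leRHS]mul1r ler_wpM2r// ler_pdivrMr// mul1r lerDl//.
have := dotG_ge0 f; rewrite -/d; set X := d f f.
move=> X0 CE; rewrite mulrDr lerBrDr => H.
have : - (C0 * (C0 + 1 + D) * X) + (E - C0 * ((C0 + 1)^-1 * E)) <= a f f.
  move: H; lra.
by apply: le_trans; rewrite lerDl subr_ge0.
Qed.

(** The successor makes the number of cells strictly larger than k len / pi, as the strict bound on
    the length of a half-cell requires. *)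
Let mids (k : R) (e : edge G) := (Num.truncn (k * len e / pi)).+1.

Lemma eigenvalue_ge (k : R) (m : nat) : 0 < k -> C0 <= k ->
  (\sum_(e : edge G) mids k e <= m)%N ->
  k ^+ 2 - 2 * C0 * k - C0 * D <= lam m.
Proof.
move=> k0 Ck summ; pose T : finType := {e : edge G & 'I_(mids k e)}.
have cT : #|T| = (\sum_(e : edge G) mids k e)%N.
  by rewrite card_tagged sumnE big_map big_enum/=; apply: eq_bigr => e _; rewrite card_ord.
pose pt (t : T) := ((tagged t)%:R + 1 / 2) * (len (tag t) / (mids k (tag t))%:R) : R.
pose L (i : 'I_#|T|) (u : gpair G) : R := u.1 (tag (enum_val i)) (pt (enum_val i)).
have cTm : (#|T| <= m)%N by rewrite cT.
have Llin i c u v : L i (c *: u + v) = c * L i u + L i v by exact: pair1E.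
have [f [Wf f0 fz fa]] := max_on_span W_sub a_bil d_bil W_psi psi_eigen psi_orth lam_homo cTm Llin.
have Hf := W_H1 Wf.
have fE : k ^+ 2 * d f f <= energyG f f.
  rewrite /d /dotG /energyG /edge_sum mulr_sumr; apply: ler_sum => e _.
  have sq (h : R -> R) : intg 0 (len e) (fun x => h x * h x) = intg 0 (len e) (fun x => h x ^+ 2).
    by apply: intg_eq => x _; rewrite expr2.
  rewrite (sq (f.1 e)) (sq (f.2 e)).
  apply: (@wirtinger_midpoints _ (len e) k (mids k e)) => //.
  - exact: len_gt0.
  - have l0 : 0 <= k * len e / pi.
      by rewrite divr_ge0 ?pi_ge0// mulr_ge0 ?ltW ?len_gt0.
    by have /andP[] := Num.Theory.truncn_itv l0.
  - exact: (Hf e).1.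
  - exact: (Hf e).2.
  - move=> i im; have := fz (enum_rank (existT _ e (Ordinal im) : T)).
    by rewrite /L enum_rankK.
have kV : 0 < k^-1 by rewrite invr_gt0.
have := formG_energy b q_L1 kV Hf; rewrite invrK -/a -/d -/C0 -/D.
rewrite ler_norml => /andP[+ _]; set E := energyG f f in fE *.
move=> H; rewrite -(ler_pM2r f0); apply: le_trans fa; rewrite -/a -/d.
set X := d f f in H f0 fE *.
have kk : k^-1 * k = 1 by rewrite mulVf// gt_eqF.
(* The factor left in front of the energy must be nonnegative for the lower bound on the energy to
   be inserted; this is the role of [C0 <= k]. *)
have h1 : 0 <= 1 - C0 * k^-1 by rewrite subr_ge0 ler_pdivrMr// mul1r.
have h2 : (1 - C0 * k^-1) * (k ^+ 2 * X) <= (1 - C0 * k^-1) * E by rewrite ler_wpM2l.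
have h3 : (1 - C0 * k^-1) * (k ^+ 2 * X) = k ^+ 2 * X - C0 * (k^-1 * k) * k * X by ring.
move: h2; rewrite h3 kk mulr1; move: H; lra.
Qed.

Let bumps (k : R) (e : edge G) := Num.truncn (k * len e / pi).

Lemma eigenvalue_le (k : R) (m : nat) : 0 < k ->
  (m < \sum_(e : edge G) bumps k e)%N ->
  lam m <= k ^+ 2 + 2 * C0 * k + C0 * D.
Proof.
move=> k0 summ; pose T : finType := {e : edge G & 'I_(bumps k e)}.
have cT : #|T| = (\sum_(e : edge G) bumps k e)%N.
  by rewrite card_tagged sumnE big_map big_enum/=; apply: eq_bigr => e _; rewrite card_ord.
pose bt (t : T) : gpair G :=
  (fun e x => if e == tag t then bump k (tagged t) x else 0,
   fun e x => if e == tag t then dbump k (tagged t) x else 0).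
have fit (t : T) : (tagged t).+1%:R * (pi / k) <= len (tag t).
  have pk0 : 0 < pi / k by rewrite divr_gt0 ?pi_gt0.
  rewrite -ler_pdivlMr//.
  have l0 : 0 <= k * len (tag t) / pi.
    by rewrite divr_ge0 ?pi_ge0// mulr_ge0 ?ltW ?len_gt0.
  have /andP[+ _] := Num.Theory.truncn_itv l0; rewrite -/(bumps k _) => H.
  rewrite invf_div mulrA [len _ * _]mulrC; apply: le_trans H.
  by rewrite ler_nat; exact: ltn_ord.
have btH t : H1G (bt t).
  move=> e; rewrite /bt /=; have [->|ne] := eqVneq e (tag t).
    by have [? ? _ _ _] := bumpP k0 (fit t).
  split; first exact: AC_cst.
  by apply: L2_cont; apply: continuous_within; exact: cst_continuous.
have btW t : W (bt t).
  apply: W_dirichlet => // -[e s]; rewrite /end_val /end_coord /bt /=.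
  have [->|//] := eqVneq e (tag t); have [_ _ b0 bl _] := bumpP k0 (fit t).
  by case: s.
have T_inj (t t' : T) : tag t = tag t' -> tagged t = tagged t' :> nat -> t = t'.
  case: t t' => [e1 j1] [e2 j2] /= ee; subst e2 => jj.
  by congr existT; exact: val_inj.
have disj t t' : t != t' -> forall e x, (bt t).1 e x * (bt t').1 e x = 0 /\
    (bt t).2 e x * (bt t').2 e x = 0.
  move=> ne e x; rewrite /bt/=; case: eqP => [et|_]; last by rewrite !mul0r.
  case: eqP => [et'|_]; last by rewrite !mulr0.
  rewrite /bump /dbump !patchE; case: ifP => [/set_mem xt|_]; last by rewrite !mul0r.
  case: ifP => [/set_mem xt'|_]; last by rewrite !mulr0.
  exfalso; move/eqP: ne; apply; have := bump_itv_disj k0 xt xt'.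
  by apply: T_inj; rewrite -et -et'.
have orth (h : gpair G -> gpair G -> edge G -> R -> R) t t' :
    (forall e x, h (bt t) (bt t') e x = 0) -> edge_sum h (bt t) (bt t') = 0.
  move=> h0; rewrite /edge_sum big1// => e _.
  rewrite (@intg_eq _ _ _ _ (fun=> 0)); last by move=> x _; exact: h0.
  by rewrite intg_cst ?mul0r// ltW ?len_gt0.
have loc (h : gpair G -> gpair G -> edge G -> R -> R) t :
    (forall e x, e != tag t -> h (bt t) (bt t) e x = 0) ->
    edge_sum h (bt t) (bt t) = intg 0 (len (tag t)) (h (bt t) (bt t) (tag t)).
  move=> h0; rewrite /edge_sum (bigD1 (tag t))//= big1 ?addr0// => e ne.
  rewrite (@intg_eq _ _ _ _ (fun=> 0)); last by move=> x _; exact: h0.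
  by rewrite intg_cst ?mul0r// ltW ?len_gt0.
have diag t : 0 < d (bt t) (bt t) /\ energyG (bt t) (bt t) = k ^+ 2 * d (bt t) (bt t).
  rewrite /d /dotG /energyG !loc; last 2 first.
  - by move=> e x /negbTE ne; rewrite /bt/= ne mul0r.
  - by move=> e x /negbTE ne; rewrite /bt/= ne mul0r.
  have [_ _ _ _ [p1 p2]] := bumpP k0 (fit t).
  rewrite (@intg_eq _ _ _ _ (fun x => bump k (tagged t) x ^+ 2)); last first.
    by move=> x _; rewrite /bt /= eqxx expr2.
  rewrite [X in X = _](@intg_eq _ _ _ _ (fun x => dbump k (tagged t) x ^+ 2)) //.
  by move=> x _; rewrite /bt /= eqxx expr2.
have mT : (m < #|T|)%N by rewrite cT.
pose bi (i : 'I_#|T|) := bt (enum_val i).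
have := test_space_bound W_sub a_bil d_bil W_psi psi_eigen psi_orth lam_homo
  a_semibounded psi_complete mT (fun i => btW (enum_val i)).
move=> [c c0]; set f := (X in let f := X in _) => /= Hf.
have Wf : W f by apply: subspace_sum => // i _; exact: subspaceZ.
(* Disjoint supports make both forms diagonal on the bumps, so [f] inherits from them the exact
   ratio [k ^+ 2] and a positive norm. *)
have quad (h : gpair G -> gpair G -> R) : bilinear_sym_on W h ->
    (forall t t', t != t' -> h (bt t) (bt t') = 0) ->
    h f f = \sum_i c i ^+ 2 * h (bi i) (bi i).
  move=> hb h0; rewrite {1}/f (bil_suml W_sub hb)//; last by move=> i _; exact: subspaceZ.
  apply: eq_bigr => i _; rewrite (bilZl W_sub hb)// /f (bil_sumr W_sub hb)//; last first.
    by move=> j _; exact: subspaceZ.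
  rewrite (bigD1 i)//= big1 ?addr0 => [|j ji].
    by rewrite (bilZr W_sub hb)// mulrA -expr2.
  rewrite (bilZr W_sub hb)// h0 ?mulr0//.
  by rewrite (inj_eq enum_val_inj) eq_sym.
have dE : d f f = \sum_i c i ^+ 2 * d (bi i) (bi i).
  by apply: quad => // t t' ne; apply: orth => e x; have [] := disj _ _ ne e x.
have eE : energyG f f = k ^+ 2 * d f f.
  rewrite dE mulr_sumr quad.
  - by apply: eq_bigr => i _; rewrite (diag _).2 mulrCA.
  - by apply: bil_W; exact: energyG_bilinear.
  - by move=> t t' ne; apply: orth => e x; have [] := disj _ _ ne e x.
have d0 : 0 < d f f.
  rewrite lt0r dE sumr_ge0 ?andbT; last first.
    by move=> i _; rewrite mulr_ge0 ?sqr_ge0// ltW ?(diag _).1.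
  apply/negP => /eqP/psumr_eq0P H; move: c0; rewrite big1 ?ltxx// => i _.
  have /eqP := H (fun j _ => mulr_ge0 (sqr_ge0 _) (ltW (diag _).1)) i isT.
  by rewrite mulf_eq0 [X in _ || X]gt_eqF ?orbF ?(diag _).1// => /eqP.
have kV : 0 < k^-1 by rewrite invr_gt0.
have := formG_energy b q_L1 kV (W_H1 Wf); rewrite invrK -/a -/d -/C0 -/D.
rewrite ler_norml => /andP[_ H]; rewrite -(ler_pM2r d0); apply: (le_trans Hf).
move: H; rewrite eE; set X := d f f.
have -> : k^-1 * (k ^+ 2 * X) = (k^-1 * k) * k * X by ring.
rewrite mulVf ?gt_eqF// mul1r; lra.
Qed.

Lemma weyl_sqrt : exists (C : R) (N : nat), forall m : nat, (N <= m)%N ->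
  0 < lam m /\ `|Num.sqrt (lam m) - pi / total_len G * m.+1%:R| <= C.
Proof.
have tl := total_len_gt0; have p0 := pi_gt0 R.
set kap := pi / total_len G; have kap0 : 0 < kap by rewrite divr_gt0.
set nE := #|edge G|.
have klen (k : R) : \sum_(e : edge G) k * len e / pi = k * total_len G / pi.
  by rewrite /total_len mulr_sumr mulr_suml.
have kapK x : kap * x * total_len G / pi = x.
  have key (p t y : R) : 0 < p -> 0 < t -> p / t * y * t / p = y.
    by move=> p1 t1; field; rewrite !gt_eqF.
  exact: key.
have natsum (F : edge G -> nat) : (\sum_e F e)%:R = \sum_e (F e)%:R :> R by rewrite natr_sum.
have truncP (k : R) e : 0 < k -> (bumps k e)%:R <= k * len e / pi < (bumps k e)%:R + 1.
  move=> k0; rewrite natr1; apply: Num.Theory.truncn_itv.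
  by rewrite divr_ge0 ?pi_ge0// mulr_ge0 ?ltW ?len_gt0.
have one : \sum_(e : edge G) (1 : R) = nE%:R by rewrite sumr_const -/nE.
(* Chosen to complete squares: (k + c)^2 dominates k^2 + 2 C0 k + C0 D, and the extra 1 in [c']
   leaves a slack 2 k that absorbs the constant terms once [k] is at least [thr]. *)
pose c := C0 + D; pose c' := C0 + 1.
have upper (m : nat) : lam m <= (kap * (m.+1%:R + nE%:R) + c) ^+ 2.
  (* Here k |G| / pi = m + 1 + nE. Rounding down loses at most one bump per edge, so more than [m]
     remain. *)
  set k := kap * _; have k0 : 0 < k by rewrite mulr_gt0// ltr_wpDr ?ltr0n.
  apply: le_trans (@eigenvalue_le k m k0 _) _.
    rewrite -(ltr_nat R) natsum.
    have : \sum_(e : edge G) k * len e / pi <= \sum_(e : edge G) ((bumps k e)%:R + 1).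
      by apply: ler_sum => e _; have /andP[_ /ltW] := truncP k e k0.
    rewrite klen kapK big_split/= one -natr1; lra.
  have -> : (k + c) ^+ 2 = k ^+ 2 + 2 * C0 * k + C0 * D +
     (2 * D * k + C0 ^+ 2 + C0 * D + D ^+ 2) by rewrite /c; ring.
  rewrite lerDl !addr_ge0 ?sqr_ge0//; last exact: mulr_ge0.
  exact: mulr_ge0 (mulr_ge0 (ler0n _ 2) D_ge0) (ltW k0).
pose thr := C0 + 1 + (C0 + 1) ^+ 2 + C0 * D.
have lower (m : nat) : thr <= kap * (m%:R - nE%:R) ->
    (kap * (m%:R - nE%:R) - c') ^+ 2 <= lam m /\ 0 < kap * (m%:R - nE%:R) - c'.
  (* Here k |G| / pi = m - nE. Rounding up adds at most one midpoint per edge, so there are at most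
     [m] conditions. *)
  set k := kap * _ => tk.
  have t1 : 0 <= (C0 + 1) ^+ 2 by exact: sqr_ge0.
  have t2 : 0 <= C0 * D by rewrite mulr_ge0.
  have t3 : 0 < (C0 + 1) ^+ 2 by rewrite exprn_gt0// ltr_wpDl.
  have k0 : 0 < k by move: tk C0_ge0; rewrite /thr; lra.
  have Ck : C0 <= k by move: tk C0_ge0; rewrite /thr; lra.
  split; last by move: tk; rewrite /thr /c'; lra.
  apply: le_trans (@eigenvalue_ge k m k0 Ck _).
    have -> : (k - c') ^+ 2 = k ^+ 2 - 2 * C0 * k - C0 * D -
      (2 * k - (C0 + 1) ^+ 2 - C0 * D) by rewrite /c'; ring.
    by rewrite gerBl; move: tk C0_ge0; rewrite /thr; lra.
  rewrite -(ler_nat R) natsum.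
  have : \sum_(e : edge G) (bumps k e)%:R <= \sum_(e : edge G) k * len e / pi.
    by apply: ler_sum => e _; have /andP[] := truncP k e k0.
  rewrite klen kapK.
  have -> : \sum_(e : edge G) (mids k e)%:R = \sum_(e : edge G) (bumps k e)%:R + nE%:R :> R.
    by under eq_bigr => e _ do rewrite /mids -natr1; rewrite big_split/= one.
  lra.
exists (kap * (nE%:R + 1) + c + c'), (Num.truncn (thr / kap + nE%:R)).+1 => m Nm.
have thr0 : 0 <= thr.
  have t1 := sqr_ge0 (C0 + 1); have t2 := mulr_ge0 C0_ge0 D_ge0.
  by move: C0_ge0; rewrite /thr; lra.
have tm : thr <= kap * (m%:R - nE%:R).
  rewrite mulrC -ler_pdivrMr// lerBrDr.
  have v0 : 0 <= thr / kap + nE%:R by rewrite addr_ge0// divr_ge0// ltW.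
  have /andP[_ /ltW h] := Num.Theory.truncn_itv v0.
  by apply: (le_trans h); rewrite ler_nat.
have [lo lo0] := lower m tm; have up := upper m.
have l0 : 0 < lam m by apply: lt_le_trans lo; rewrite exprn_gt0.
split=> //.
set s := Num.sqrt (lam m).
have s0 : 0 <= s by exact: sqrtr_ge0.
have s2 : s ^+ 2 = lam m by rewrite sqr_sqrtr// ltW.
have c_ge0 : 0 <= c by exact: addr_ge0.
have c'_ge0 : 0 <= c' by exact: addr_ge0.
have h1 : kap * (m%:R - nE%:R) - c' <= s.
  by rewrite -(ler_pXn2r (n := 2)) ?nnegrE ?s2// ltW.
have h2 : s <= kap * (m.+1%:R + nE%:R) + c.
  rewrite -(ler_pXn2r (n := 2)) ?nnegrE ?s2// addr_ge0// mulr_ge0 ?addr_ge0//.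
  exact: ltW.
rewrite ler_norml; apply/andP; split.
  move: h1; rewrite -natr1 mulrBr !mulrDr mulr1; lra.
move: h2; rewrite !mulrDr mulr1; have := kap0; lra.
Qed.

End weyl.

(** * From the complex form to the real one *)

Section weak_derivatives.
Context {R : realType}.
Notation mu := (@lebesgue_measure R).
Implicit Types (l x : R) (f g h : R -> R) (F : R -> R[i]).

(** Extended by 0 to the line, [h] has a primitive that is identically 0, and Lebesgue's
    differentiation theorem applies. *)
Lemma primitive_eq0_ae l h : L1 0 l h -> (forall x, 0 <= x <= l -> intg 0 x h = 0) ->
  {ae mu, forall x, 0 <= x <= l -> h x = 0}.
Proof.
move=> lh h0; pose f := h \_ `[0, l].
have fT : mu.-integrable setT (EFin \o f).
  by rewrite -restrict_EFin; apply/integrable_restrict => //=; rewrite setTI.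
have fy (y : R) : mu.-integrable `]-oo, y] (EFin \o f) by apply: integrableS fT.
have := FTC1Ny fy (open_integrable_locally openT fT).
have -> : (fun x => \int[mu]_(t in `]-oo, x]) f t) = cst 0.
  apply/funext => x; rewrite /f -Rintegral_mkcondr.
  have [x0|x0] := ltP x 0.
    rewrite (_ : _ `&` _ = set0) ?Rintegral_set0//.
    rewrite -subset0 => y [/=]; rewrite !in_itv/= => yx /andP[y0 _].
    by have := le_lt_trans (le_trans y0 yx) x0; rewrite ltxx.
  have [xl|lx] := leP x l.
    rewrite (_ : _ `&` _ = `[0, x]%classic); first by apply: h0; rewrite x0.
    apply/seteqP; split => y /=; rewrite !in_itv/=.
      by move=> [-> /andP[->]].
    by move=> /andP[-> yx]; rewrite yx (le_trans yx).
  have [l0|l0] := leP 0 l; last first.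
    rewrite (_ : _ `&` _ = set0) ?Rintegral_set0//.
    rewrite -subset0 => y [/= _]; rewrite in_itv/= => /andP[y0 yl].
    by have := le_lt_trans (le_trans y0 yl) l0; rewrite ltxx.
  rewrite (_ : _ `&` _ = `[0, l]%classic); first by apply: h0; rewrite l0/=.
  apply/seteqP; split => y /=; rewrite !in_itv/=; first by case.
  by move=> /andP[-> yl]; rewrite yl (le_trans yl (ltW lx)).
apply: ae_mono => x [_]; rewrite derive1_cst => /esym fx xl.
by move: fx; rewrite /f patchE mem_set//= in_itv.
Qed.

Lemma weak_deriv_real l f g : 0 <= l -> AC 0 l f g -> L2 0 l g ->
  is_weak_deriv l (fun x => (f x)%:C%C) (fun x => (g x)%:C%C).
Proof.
move=> l0 fg [mg g2]; split.
  split=> //=; last first.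
    by apply: L1_eq g2 => x _; rewrite /csqnorm /= [0 ^+ 2]expr0n /= addr0.
move=> x /andP[x0 xl]; rewrite /cintegral /=.
have := AC_intg fg (lexx 0) x0 xl => /eqP; rewrite subr_eq addrC => /eqP ->.
rewrite -/(intg 0 x g) -/(intg 0 x (fun=> 0)) intg_cst// mul0r.
by apply/eqP; rewrite eq_complex /= addr0 !eqxx.
Qed.

Lemma in_L2_Re l F : in_L2 l F -> L2 0 l (fun x => complex.Re (F x)).
Proof.
move=> [mr mi i2]; split=> //; apply: L1_le i2.
  by apply: measurable_funX.
by move=> x _; rewrite ger0_norm ?sqr_ge0// /csqnorm lerDl sqr_ge0.
Qed.

Lemma in_L2_Im l F : in_L2 l F -> L2 0 l (fun x => complex.Im (F x)).
Proof.
move=> [mr mi i2]; split=> //; apply: L1_le i2.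
  by apply: measurable_funX.
by move=> x _; rewrite ger0_norm ?sqr_ge0// /csqnorm lerDr sqr_ge0.
Qed.

Lemma is_weak_deriv_Re l f F : is_weak_deriv l (fun x => (f x)%:C%C) F ->
  [/\ AC 0 l f (fun x => complex.Re (F x)), L2 0 l (fun x => complex.Re (F x)) &
    {ae mu, forall x, 0 <= x <= l -> complex.Im (F x) = 0}].
Proof.
move=> [F2 fE]; have re2 := in_L2_Re F2; have im2 := in_L2_Im F2.
split=> //.
  split; first exact: L2_L1.
  by move=> x xl; have := congr1 (@complex.Re R) (fE x xl).
apply: primitive_eq0_ae; first exact: L2_L1.
move=> x xl; have := congr1 (@complex.Im R) (fE x xl); rewrite /= add0r.
by move=> /esym.
Qed.

Lemma AC_deriv_ae l f g h : AC 0 l f g -> AC 0 l f h ->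
  {ae mu, forall x, 0 <= x <= l -> g x = h x}.
Proof.
move=> fg fh; have lg := AC_L1 fg; have lh := AC_L1 fh.
apply: (ae_mono _ (@primitive_eq0_ae l (fun x => g x - h x) (L1B lg lh) _)).
  by move=> x H /H /eqP; rewrite subr_eq0 => /eqP.
move=> x /andP[x0 xl]; rewrite intgB; [|exact: L1_sub lg|exact: L1_sub lh].
by rewrite -(AC_intg fg)// -(AC_intg fh)// subrr.
Qed.

(** [weak_deriv] is an arbitrary, complex-valued choice. A known real derivative agrees with it
    almost everywhere, because the difference has zero primitive, and this is all that the integrals
    see. *)
Lemma weak_deriv_ae l f g : 0 <= l -> AC 0 l f g -> L2 0 l g ->
  let F := weak_deriv l (fun x => (f x)%:C%C) in
  in_L2 l F /\ {ae mu, forall x, 0 <= x <= l ->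
    complex.Re (F x) = g x /\ complex.Im (F x) = 0}.
Proof.
move=> l0 fg g2 F.
have wF : is_weak_deriv l (fun x => (f x)%:C%C) F.
  by apply: (@xgetPex _ (fun=> 0) [set g | is_weak_deriv l (fun x => (f x)%:C%C) g]);
    exists (fun x => (g x)%:C%C); exact: weak_deriv_real.
have [fRe _ im0] := is_weak_deriv_Re wF; split; first by case: wF.
apply: ae_mono (ae_and (AC_deriv_ae fRe fg) im0) => x [h1 h2] xl.
by rewrite h1// h2.
Qed.

Lemma Re_mul_conj (z z' : R[i]) : complex.Re (z * z'^*) =
  complex.Re z * complex.Re z' + complex.Im z * complex.Im z'.
Proof. by case: z z' => [a b] [c d]; rewrite /= mulrN opprK. Qed.

Lemma conj_real_complex (x : R) : ((x%:C%C : R[i])^*) = x%:C%C.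
Proof. by apply/eqP; rewrite eq_complex /= oppr0 !eqxx. Qed.

End weak_derivatives.

(** * The real form and its eigenpairs *)

Section real_form.
Context {R : realType} (G : metric_graph R).
Notation mu := (@lebesgue_measure R).
Variables (q : edge G -> R -> R) (B : 'M[R[i]]_#|edge_end G|)
  (w : edge_end G -> R) (V0 : {set vert G}).
Hypotheses (q_L1 : forall e, L1 0 (len e) (q e)) (B_herm : B \is hermsymmx).

Implicit Types (u v : gpair G) (e : edge G) (f : edge G -> R -> R).

(** For real functions, the real part of the boundary term involves [B] through these numbers; [B]
    being Hermitian, they form a symmetric matrix. *)
Definition reB (i j : edge_end G) : R := complex.Re (B (enum_rank i) (enum_rank j)).

Lemma reB_sym i j : reB i j = reB j i.
Proof.
rewrite /reB; move/is_hermitianmxP: B_herm => ->; rewrite expr0 scale1r !mxE.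
move/is_hermitianmxP: B_herm => BE; rewrite {2}BE expr0 scale1r !mxE.
by case: (B _ _).
Qed.

Lemma ReD (x y : R[i]) : complex.Re (x + y) = complex.Re x + complex.Re y.
Proof. by case: x y => [? ?] [? ?]. Qed.

Lemma Re_sum (I : finType) (F : I -> R[i]) :
  complex.Re (\sum_i F i) = \sum_i complex.Re (F i).
Proof. by apply: (big_morph (@complex.Re R) (id1 := 0)) => // x y; exact: ReD. Qed.

Definition form_domG u := [/\ H1G u,
  forall i j : edge_end G, vert_of i = vert_of j -> vert_of i \notin V0 ->
    w i * end_val u.1 i = w j * end_val u.1 j &
  forall i : edge_end G, vert_of i \in V0 -> end_val u.1 i = 0].

Lemma form_domG_sub : subspace_pred form_domG.
Proof.
have [z s] := @H1G_subspace R G; split=> [|k u v [Hu cu zu] [Hv cv zv]].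
  by split=> // *; rewrite /end_val /= ?mulr0.
have E i : end_val (k *: u + v).1 i = k * end_val u.1 i + end_val v.1 i.
  exact: pair1E.
split=> [|i j ij iV|i iV]; first exact: s.
  by rewrite !E !mulrDr !(mulrCA _ k) (cu i j)// (cv i j).
by rewrite E zu// zv// mulr0 addr0.
Qed.

Lemma form_domG_dirichlet u : H1G u -> (forall i, end_val u.1 i = 0) -> form_domG u.
Proof. by move=> Hu z; split=> // *; rewrite !z ?mulr0. Qed.

Lemma form_domG_in u : form_domG u -> in_form_dom w V0 (gfun_of_real u.1).
Proof.
move=> [Hu cu zu]; split=> [e|i j ij iV|i iV].
- exists (fun x => (u.2 e x)%:C%C); apply: weak_deriv_real.
  + exact/ltW/len_gt0.
  + exact: (Hu e).1.
  + exact: (Hu e).2.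
- rewrite /end_value /gfun_of_real -!rmorphM /=.
  by congr (_ %:C)%C; exact: cu.
- by have := zu i iV; rewrite /end_val /end_value /gfun_of_real => ->.
Qed.

Lemma in_form_domG f : in_form_dom w V0 (gfun_of_real f) ->
  exists g, form_domG (f, g).
Proof.
move=> [h1 cu zu].
have : forall e, exists g, AC 0 (len e) (f e) g /\ L2 0 (len e) g.
  move=> e; have [F /is_weak_deriv_Re[a1 a2 _]] := h1 e.
  by exists (fun x => complex.Re (F x)).
move=> /choice[g Hg]; exists g; split=> //.
- move=> i j ij iV; have := cu i j ij iV; rewrite /end_value /gfun_of_real -!rmorphM /=.
  by move=> /(congr1 (@complex.Re R)).
- by move=> i iV; have := zu i iV => /(congr1 (@complex.Re R)).
Qed.

Lemma Re_schrodinger_form u v : H1G u -> H1G v ->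
  complex.Re (schrodinger_form q B (gfun_of_real u.1) (gfun_of_real v.1)) =
  formG q reB u v.
Proof.
move=> Hu Hv; rewrite /schrodinger_form /formG ReD.
rewrite !Re_sum; congr (_ + _); last first.
  apply: eq_bigr => i _; rewrite Re_sum; apply: eq_bigr => j _.
  rewrite /end_value /gfun_of_real conj_real_complex /reB.
  by case: (B _ _) => x y /=; rewrite /end_val !(mulr0, mul0r, subr0, addr0).
rewrite /energyG /potentialG /edge_sum -big_split/=; apply: eq_bigr => e _.
have [au lu] := Hu e; have [av lv] := Hv e; have l0 := ltW (len_gt0 e).
have luv : L1 0 (len e) (fun x => u.2 e x * v.2 e x) by exact: L2_mul.
have lq := potentialG_L1 q_L1 e Hu Hv.
rewrite -intgD//; have lsum := L1D luv lq.
have [[mur mui _] aeu] := weak_deriv_ae l0 au lu.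
have [[mvr mvi _] aev] := weak_deriv_ae l0 av lv.
set Fu := weak_deriv _ _ in mur mui aeu *; set Fv := weak_deriv _ _ in mvr mvi aev *.
pose integrand x := (complex.Re (Fu x) * complex.Re (Fv x) +
  complex.Im (Fu x) * complex.Im (Fv x)) + q e x * u.1 e x * v.1 e x.
transitivity (intg 0 (len e) integrand).
  apply: intg_eq => x _; rewrite /integrand /gfun_of_real conj_real_complex.
  rewrite ReD.
  by rewrite Re_mul_conj; congr (_ + _); rewrite /= !(mulr0, mul0r, subr0, addr0).
apply/esym/(proj2 (intg_ae lsum _ _)).
  apply: measurable_funD; last exact: L1_measurable lq.
  by apply: measurable_funD; exact: measurable_funM.
apply: ae_mono (ae_and aeu aev) => x [h1 h2] xl; rewrite /integrand.
have [-> ->] := h1 xl; have [-> _] := h2 xl; by rewrite mul0r addr0.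
Qed.

Lemma L2G_dot_real (f g : edge G -> R -> R) :
  L2G_dot (gfun_of_real f) (gfun_of_real g) =
  (\sum_e intg 0 (len e) (fun x => f e x * g e x))%:C%C.
Proof.
rewrite /L2G_dot rmorph_sum /=; apply: eq_bigr => e _.
rewrite (_ : (fun x => _) = (fun x => (f e x * g e x)%:C%C)); last first.
  by apply/funext => x; rewrite /gfun_of_real conj_real_complex rmorphM.
apply/eqP; rewrite /cintegral eq_complex /= eqxx /=.
by rewrite -/(intg 0 (len e) (fun=> 0)) intg_cst ?mul0r// ltW ?len_gt0.
Qed.

Lemma pairB1E u v e x : (u - v).1 e x = u.1 e x - v.1 e x.
Proof. by case: u v => [? ?] [? ?]. Qed.

Lemma pair_sum1E n (c : 'I_n -> R) (F : 'I_n -> gpair G) e x :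
  (\sum_(k < n) c k *: F k).1 e x = \sum_(k < n) c k * (F k).1 e x.
Proof. by elim/big_rec2: _ => // k y u _ <-; exact: pair1E. Qed.

Section eigenfunctions.
Variables (lam : nat -> R) (psi : nat -> edge G -> R -> R).
Hypothesis psi_basis : eigenbasis q B w V0 lam psi.

Lemma eigenpairs : exists Psi : nat -> gpair G, [/\ forall n, (Psi n).1 = psi n,
  forall n, form_domG (Psi n),
  forall n u, form_domG u -> formG q reB (Psi n) u = lam n * dotG (Psi n) u,
  forall m n, dotG (Psi m) (Psi n) = (m == n)%:R &
  forall u, form_domG u -> (fun N =>
    let r := u - \sum_(k < N) dotG u (Psi k) *: Psi k in dotG r r) @ \oo --> (0 : R)].
Proof.
have [[_ orth compl] eig _] := psi_basis.
have /choice[g Hg] : forall n, exists g, form_domG (psi n, g).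
  by move=> n; have [+ _ _] := eig n; exact: in_form_domG.
pose Psi n : gpair G := (psi n, g n); exists Psi.
(* [dotG] reads first components only, so [f] merely fills the second slot. *)
have dotE f n : L2G_dot (gfun_of_real f) (gfun_of_real (psi n)) =
    (dotG ((f, f) : gpair G) (Psi n))%:C%C by rewrite L2G_dot_real.
split=> //.
- move=> n u Wu; have Wn := Hg n; have [_ _ H] := eig n.
  have Hu : H1G u by case: Wu.
  have Hn : H1G (Psi n) by case: Wn.
  rewrite -(Re_schrodinger_form Hn Hu) H; last exact: form_domG_in.
  rewrite (_ : (fun e x => _) = gfun_of_real (fun e x => lam n * psi n e x)); last first.
    by apply/funext => e; apply/funext => x; rewrite /gfun_of_real rmorphM.
  rewrite L2G_dot_real /= /dotG /edge_sum mulr_sumr; apply: eq_bigr => e _.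
  rewrite -intgZ; first by apply: intg_eq => x _; rewrite mulrA.
  by apply: L2_mul; apply: AC_L2; [exact: (Hn e).1|exact: (Hu e).1].
- move=> m n; have := congr1 (@complex.Re R) (orth m n); rewrite dotE /= => E.
  by rewrite -[LHS]/(dotG ((psi m, psi m) : gpair G) (Psi n)) E; case: (m == n).
- move=> u Wu; have Hu : H1G u by case: Wu.
  have uL2 : in_L2G (gfun_of_real u.1).
    move=> e; have [_ u2] := AC_L2 (Hu e).1; split=> /=.
    + exact: (AC_L2 (Hu e).1).1.
    + exact: measurable_cst.
    + by apply: L1_eq u2 => x _; rewrite /csqnorm /= expr0n/= addr0.
  suff -> : (fun N : nat => let r := u - \sum_(k < N) dotG u (Psi k) *: Psi k in dotG r r) =
    (fun N => L2G_sqnorm (fun e x => gfun_of_real u.1 e x - \sum_(k < N)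
      L2G_dot (gfun_of_real u.1) (gfun_of_real (psi k)) * gfun_of_real (psi k) e x)).
    exact: compl.
  apply/funext => N /=.
  rewrite /L2G_sqnorm /dotG /edge_sum; apply: eq_bigr => e _; apply: intg_eq => x _.
  set r := u - _.
  have -> : gfun_of_real u.1 e x - \sum_(k < N)
      L2G_dot (gfun_of_real u.1) (gfun_of_real (psi k)) * gfun_of_real (psi k) e x =
      (r.1 e x)%:C%C.
    have -> : r.1 e x = u.1 e x - \sum_(k < N) dotG u (Psi k) * psi k e x.
      by rewrite /r pairB1E pair_sum1E.
    rewrite rmorphB rmorph_sum; congr (_ - _); apply: eq_bigr => k _.
    by rewrite L2G_dot_real rmorphM.
  by rewrite /csqnorm /= expr0n/= addr0 expr2.
Qed.

End eigenfunctions.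
End real_form.

(** * Counting nodal domains *)

Section nodal_count_bounds.
Context {R : realType} (G : metric_graph R).
Implicit Types (e : edge G) (x y t : R) (psi : edge G -> R -> R).
Local Open Scope quotient_scope.

Lemma count_sub_lt (T : eqType) (a b : pred T) (s : seq T) z :
  (forall w, a w -> b w) -> z \in s -> ~~ a z -> b z -> (count a s < count b s)%N.
Proof.
move=> ab + az bz; elim: s => //= w s IH; rewrite inE => /predU1P[<-|/IH zs].
  by rewrite (negbTE az) bz add0n add1n ltnS; exact: sub_count.
by rewrite -addnS leq_add//; case: (a w) (ab w) => // ->.
Qed.

(** A retraction of the line onto [[0, l]]: it makes the parametrisation of an edge a total
    continuous map, to which facts about real intervals apply directly. *)
Definition clamp (l x : R) : R := Order.max 0 (Order.min x l).

Lemma clamp_id l x : 0 <= x <= l -> clamp l x = x.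
Proof. by move=> /andP[x0 xl]; rewrite /clamp min_l// max_r. Qed.

Lemma clamp_in l x : 0 < l -> clamp l x \in (`[0, l]%classic : set R).
Proof.
move=> l0; apply/mem_set; rewrite /= in_itv/= /clamp le_max lexx/= ge_max ltW//=.
by rewrite ge_min lexx orbT.
Qed.

Lemma clamp_continuous l : continuous (clamp l).
Proof.
move=> x; apply: (@continuous_max _ _ (fun=> 0) (fun x => Order.min x l)).
  exact: cvg_cst.
apply: (@continuous_min _ _ id (fun=> l)); [exact: cvg_id|exact: cvg_cst].
Qed.

Definition edge_pt e x : edge_point G :=
  existT _ e (exist _ (clamp (len e) x) (clamp_in x (len_gt0 e))).

Definition graph_pt e x : graph_space G := \pi_(graph_space G) (edge_pt e x).

Lemma edge_pt_surj (p : edge_point G) : exists e x,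
  0 <= x <= len e /\ p = edge_pt e x.
Proof.
case: p => e [x xl]; have xl' : 0 <= x <= len e by have := set_mem xl; rewrite /= in_itv.
exists e, x; split => //; rewrite /edge_pt; congr existT.
by apply: val_inj; rewrite /= clamp_id.
Qed.

Lemma graph_pt_continuous e : continuous (graph_pt e).
Proof.
move=> x; apply: (@continuous_comp _ _ _ (edge_pt e) (\pi_(graph_space G))).
  have c1 : continuous (fun x => exist _ (clamp (len e) x)
      (clamp_in x (len_gt0 e)) : set_type (`[0, len e]%classic : set R)).
    by move=> y; apply: continuous_comp_initial; exact: clamp_continuous.
  exact: (continuous_comp (c1 x) (@existT_continuous _
    (fun e => set_type (`[0, len e]%classic : set R)) e _)).
exact: pi_continuous.
Qed.

Lemma graph_pt_inj e x (p : edge_point G) : 0 < x < len e ->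
  \pi_(graph_space G) p = graph_pt e x -> p = edge_pt e x.
Proof.
move=> /andP[x0 xl] /eqmodP; rewrite /= /Defs.glue /edge_point_loc/=.
rewrite clamp_id ?ltW// (gt_eqF x0) (lt_eqF xl).
have [e' [y [yl ->]]] := edge_pt_surj p; rewrite /= (clamp_id yl).
case: ifP => // _; case: ifP => // _ /eqP[-> ->] //.
Qed.

Definition edge_arc e (A : set R) : set (graph_space G) := graph_pt e @` A.

Lemma preimage_edge_arc e (A : set R) : (forall x, A x -> 0 < x < len e) ->
  \pi_(graph_space G) @^-1` edge_arc e A = [set p | exists2 x, A x & p = edge_pt e x].
Proof.
move=> Ain; apply/seteqP; split => p /= [x Ax].
  by move=> /esym/(graph_pt_inj (Ain _ Ax)) ->; exists x.
by move=> ->; exists x.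
Qed.

Notation edge_inj := (existT (fun e => set_type (`[0, len e]%classic : set R))).

Lemma edge_fiber e (A : set R) : (forall x, A x -> 0 < x < len e) ->
  edge_inj e @^-1` [set p | exists2 x, A x & p = edge_pt e x] = \val @^-1` A.
Proof.
move=> Ain; apply/seteqP; split => z /=.
  move=> [x Ax E].
  have {E}-> := existT_inj2 E.
  by rewrite /= clamp_id//; have /andP[/ltW -> /ltW ->] := Ain _ Ax.
move=> Az; exists (\val z) => //.
rewrite /edge_pt; congr existT; apply: val_inj => /=.
by rewrite clamp_id//; have /andP[/ltW -> /ltW ->] := Ain _ Az.
Qed.

Lemma edge_fiber0 e e' (A : set R) : e' != e ->
  edge_inj e' @^-1` [set p | exists2 x, A x & p = edge_pt e x] = set0.
Proof.
move=> /eqP ne; rewrite -subset0 => z /= [x _ E].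
by apply: ne; exact: (congr1 tag E).
Qed.

(** An arc inside the open edge is saturated for the gluing, so openness can be tested on one edge
    at a time: the preimage is [A] on [e] and empty on the others. *)
Lemma open_edge_arc e (A : set R) : (forall x, A x -> 0 < x < len e) ->
  open A -> open (edge_arc e A).
Proof.
move=> Ain oA; rewrite /open/= /quotient_open preimage_edge_arc//.
apply/sigT_openP => e'.
have [->|ne] := eqVneq e' e; last by rewrite edge_fiber0//; exact: open0.
rewrite edge_fiber//.
by apply: open_comp => // x _; exact: initial_continuous.
Qed.

Lemma closed_edge_arc e (A : set R) : (forall x, A x -> 0 < x < len e) ->
  closed A -> closed (edge_arc e A).
Proof.
move=> Ain cA; rewrite -openC; suff : open (\pi_(graph_space G) @^-1` (~` edge_arc e A)) by [].
rewrite -preimage_setC preimage_edge_arc//.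
apply/sigT_openP => e'; rewrite -preimage_setC openC.
have [->|ne] := eqVneq e' e; last by rewrite edge_fiber0//; exact: closed0.
rewrite edge_fiber//.
by apply: preimage_closed => // x _; exact: initial_continuous.
Qed.

Lemma nonzero_set_pt psi e x : 0 < x < len e ->
  nonzero_set psi (graph_pt e x) -> psi e x != 0.
Proof.
move=> xl [p fp /(graph_pt_inj xl) pE]; move: fp; rewrite pE /= clamp_id//.
by have /andP[/ltW -> /ltW ->] := xl.
Qed.

(** The open arc is open in the graph and its closure adds only zeros of [psi]. It is thus separated
    from the rest of the nonzero set, and a component meeting it stays inside. *)
Lemma component_between_zeros psi e a b t : 0 < a -> a < t -> t < b -> b < len e ->
  psi e a = 0 -> psi e b = 0 ->
  nonzero_set psi (graph_pt e t) ->
  closure (connected_component (nonzero_set psi) (graph_pt e t)) `<=`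
    edge_arc e `[a, b].
Proof.
move=> a0 at_ tb bl fa fb Nt.
have inI x : `[a, b]%classic x -> 0 < x < len e.
  by rewrite /= in_itv/= => /andP[ax xb]; rewrite (lt_le_trans a0)//= (le_lt_trans xb).
have inO x : `]a, b[%classic x -> 0 < x < len e.
  by rewrite /= in_itv/= => /andP[ax xb]; rewrite (lt_trans a0)//= (lt_trans xb).
have cI : closed (edge_arc e `[a, b]) by apply: closed_edge_arc => //; exact: itv_closed.
have oO : open (edge_arc e `]a, b[) by apply: open_edge_arc => //; exact: itv_open.
set N := nonzero_set psi; set C := connected_component _ _.
pose B := N `\` edge_arc e `]a, b[.
suff CO : C `<=` edge_arc e `]a, b[.
  have -> : edge_arc e `[a, b] = closure (edge_arc e `[a, b]) by apply/closure_id.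
  apply: closureS; apply: (subset_trans CO).
  by apply: image_subset => x /=; rewrite !in_itv/= => /andP[/ltW -> /ltW ->].
have sep : separated (edge_arc e `]a, b[) B.
  split.
    rewrite -subset0 => z [cz [Nz Oz]].
    have : edge_arc e `[a, b] z.
      have -> : edge_arc e `[a, b] = closure (edge_arc e `[a, b]) by apply/closure_id.
      apply: closureS cz.
      by apply: image_subset => x /=; rewrite !in_itv/= => /andP[/ltW -> /ltW ->].
    move=> [x xI zE]; apply: Oz; exists x => //.
    have := nonzero_set_pt (inI _ xI); rewrite zE => /(_ _ Nz) fx.
    move: xI; rewrite /= !in_itv/= !le_eqVlt => /andP[/predU1P[ax|->] /predU1P[xb|->]] //.
    - by move: fx; rewrite -ax fa eqxx.
    - by move: fx; rewrite -ax fa eqxx.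
    - by move: fx; rewrite xb fb eqxx.
  rewrite -subset0 => z [Oz clBz].
  by have [w [[_ nOw] Ow]] := clBz _ (open_nbhs_nbhs (conj oO Oz)).
have CAB : C `<=` edge_arc e `]a, b[ `|` B.
  move=> z /connected_component_sub Nz; have [Oz|Oz] := pselect (edge_arc e `]a, b[ z).
    by left.
  by right.
have [//|CB] := connected_subset sep CAB (@component_connected _ N (graph_pt e t)).
have [_] := CB _ (connected_component_refl Nt); case; exists t => //.
by rewrite /= in_itv/= at_.
Qed.

Lemma connected_arc psi e x y : 0 <= x -> y <= len e ->
  (forall z, x <= z <= y -> psi e z != 0) ->
  edge_arc e `[x, y] `<=` nonzero_set psi /\ connected (edge_arc e `[x, y]).
Proof.
move=> x0 yl nz; split.
  move=> _ [z + <-]; rewrite /= in_itv/= => /andP[xz zy].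
  exists (edge_pt e z) => //=; rewrite clamp_id ?nz ?xz//.
  by rewrite (le_trans x0)//= (le_trans zy).
apply: connected_continuous_connected; first exact: segment_connected.
apply: continuous_subspaceT; exact: graph_pt_continuous.
Qed.

(* Two points of an edge with the same number of zeros below them are joined by
   an arc without zeros. *)
Lemma nodal_count_le psi (Z : edge G -> seq R) (E0 : {set edge G}) :
  (forall e x, e \notin E0 -> 0 <= x <= len e -> psi e x = 0) ->
  (forall e x, e \in E0 -> 0 <= x <= len e -> psi e x = 0 -> x \in Z e) ->
  finite_set (nodal_domains psi) /\
  (nodal_count psi <= \sum_(e in E0) (size (Z e)).+1)%N.
Proof.
move=> vanish zeros.
pose below e x := count (fun z => z < x) (Z e).
pose dom e x := closure (connected_component (nonzero_set psi) (graph_pt e x)).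
(* The domain on [e] with [i] listed points below, or [set0] if there is none. As [i] takes
   [(size (Z e)).+1] values, this lists all domains met on [e]. *)
pose cell e i : set (graph_space G) := xget set0
  [set U | exists x, [/\ 0 <= x <= len e, psi e x != 0, below e x = i & U = dom e x]].
pose S := flatten [seq [seq cell e i | i <- iota 0 (size (Z e)).+1] | e <- enum E0].
have mono e x y : e \in E0 -> 0 <= x <= len e -> 0 <= y <= len e ->
    psi e x != 0 -> psi e y != 0 -> below e x = below e y -> x <= y -> dom e x = dom e y.
  move=> eE /andP[x0 xl] /andP[y0 yl] fx fy bxy xy.
  have nz z : x <= z <= y -> psi e z != 0.
    move=> /andP[xz zy]; apply/negP => /eqP fz.
    have zZ : z \in Z e by apply: zeros => //; rewrite (le_trans x0)//= (le_trans zy).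
    have xz' : x < z by rewrite lt_neqAle xz andbT; apply/eqP => E; move: fx; rewrite E fz eqxx.
    have zy' : z < y by rewrite lt_neqAle zy andbT; apply/eqP => E; move: fy; rewrite -E fz eqxx.
    suff : (below e x < below e y)%N by rewrite bxy ltnn.
    apply: (count_sub_lt _ zZ); rewrite ?zy' -?leNgt//.
    by move=> w wx; exact: lt_le_trans xy.
  have [sub con] := connected_arc x0 yl nz.
  rewrite /dom (@same_connected_component _ _ _ (graph_pt e y))//.
  by exists (edge_arc e `[x, y]); [split=> //; exists x|exists y];
    rewrite //= in_itv/= lexx ?andbT.
have domS : nodal_domains psi `<=` [set` S].
  move=> _ [_ [p + <-] <-]; have [e [x [xl ->]]] := edge_pt_surj p.
  rewrite /= (clamp_id xl) => fx.
  have eE : e \in E0 by apply/negPn/negP => /vanish/(_ xl) E; move: fx; rewrite /= E eqxx.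
  have cellE : cell e (below e x) = dom e x.
    have : exists U, exists y,
      [/\ 0 <= y <= len e, psi e y != 0, below e y = below e x & U = dom e y].
      by exists (dom e x), x.
    move=> /(xgetPex set0) [y [yl fy bxy E]]; rewrite /cell [LHS]E.
    by have [yx|/ltW xy] := leP y x; [|apply/esym]; apply: mono.
  rewrite -/(graph_pt e x) -/(dom e x) -cellE /=.
  apply/flattenP; exists [seq cell e i | i <- iota 0 (size (Z e)).+1].
    by apply/mapP; exists e => //; rewrite mem_enum.
  by apply: map_f; rewrite mem_iota /= add0n ltnS count_size.
(* Finiteness must be established along with the bound, since [fset_set] of an infinite set is empty
   and the count would then be 0. *)
have fin : finite_set (nodal_domains psi) by exact: sub_finite_set domS (finite_seq S).
split=> //; apply: (@leq_trans (size S)).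
  rewrite /nodal_count; apply: uniq_leq_size; first exact: fset_uniq.
  by move=> U; rewrite in_fset_set// => /set_mem /domS.
rewrite /S size_flatten sumnE /shape -map_comp big_map big_enum/=.
by apply: leq_sum => e _; rewrite size_map size_iota.
Qed.

(** The domain through [t e j] lies in the arc between [a e j] and [a e j.+1], which contains no
    other witness; hence these domains are pairwise distinct. *)
Lemma nodal_count_ge psi (n : edge G -> nat) : finite_set (nodal_domains psi) ->
  (forall e, alternates (n e) (len e) (psi e)) ->
  (\sum_e n e <= nodal_count psi)%N.
Proof.
move=> fin alt.
have [a alt'] := choice alt; have [t {}alt'] := choice alt'.
pose dom e j := closure (connected_component (nonzero_set psi) (graph_pt e (t e j))).
have Nt e j : (j < n e)%N -> nonzero_set psi (graph_pt e (t e j)).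
  move=> /alt'[a0 at_ ta al [_ _ ft]]; exists (edge_pt e (t e j)) => //=.
  by rewrite clamp_id// !ltW ?(lt_trans a0 at_)// (lt_trans ta).
pose F (k : {e : edge G & 'I_(n e)}) := dom (tag k) (tagged k).
have amono e i j : (i <= j)%N -> (j <= n e)%N -> a e i <= a e j.
  elim: j => [|j IH]; first by rewrite leqn0 => /eqP ->.
  rewrite leq_eqVlt => /predU1P[->//|]; rewrite ltnS => ij jn.
  apply: (le_trans (IH ij (ltnW jn))); have [_ at_ ta _ _] := alt' e j jn.
  exact/ltW/(lt_trans at_ ta).
have domP e j : (j < n e)%N -> dom e j (graph_pt e (t e j)) /\
    dom e j `<=` edge_arc e `[a e j, a e j.+1].
  move=> jn; have [a0 at_ ta al [fa fb _]] := alt' e j jn; split.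
    exact/subset_closure/connected_component_refl/Nt.
  exact: component_between_zeros (Nt _ _ jn).
have tj e i j : (i < n e)%N -> (j < n e)%N ->
    a e j <= t e i <= a e j.+1 -> i = j.
  move=> iN jN /andP[ati tia]; have [_ at_ ta _ _] := alt' e i iN.
  apply/eqP; rewrite eqn_leq leqNgt [(j <= i)%N]leqNgt; apply/andP; split; apply/negP => ij.
    have := amono e _ _ ij (ltnW iN) => h.
    by have := lt_le_trans at_ (le_trans tia h); rewrite ltxx.
  have := amono e _ _ ij (ltnW jN) => h.
  by have := lt_le_trans ta (le_trans h ati); rewrite ltxx.
have Finj : injective F.
  move=> [e i] [e' j]; rewrite /F/= => FE.
  have [h1 _] := domP e i (ltn_ord i); have [_ h2] := domP e' j (ltn_ord j).
  move: h1; rewrite FE => /h2[x]; rewrite /= in_itv/= => xa.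
  have [a0 at_ ta al _] := alt' e i (ltn_ord i).
  have ti : 0 < t e i < len e by rewrite (lt_trans a0)//= (lt_trans ta).
  move=> /(graph_pt_inj ti) E; have Ee : e' = e := congr1 tag E.
  subst e'; have := congr1 val (existT_inj2 E) => /=.
  have [b0 bt tb bl _] := alt' e j (ltn_ord j); have /andP[xa1 xa2] := xa.
  have [_ _ _ bl0 _] := alt' e j (ltn_ord j).
  rewrite !clamp_id; last 2 first.
  - by have /andP[/ltW -> /ltW ->] := ti.
  - by rewrite (le_trans (ltW b0))//= (le_trans xa2)// ltW.
  move=> xt; congr existT; apply: val_inj => /=.
  by apply: (tj e) => //; rewrite -xt.
have -> : (\sum_e n e = size [seq F k | k <- enum {: {e : edge G & 'I_(n e)}}])%N.
  rewrite size_map -cardE card_tagged sumnE big_map big_enum/=.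
  by apply: eq_bigr => e _; rewrite card_ord.
rewrite /nodal_count; apply: uniq_leq_size.
  by rewrite map_inj_uniq// enum_uniq.
move=> U /mapP[k _ ->]; rewrite in_fset_set//; apply/mem_set.
by exists (graph_pt (tag k) (t (tag k) (tagged k))) => //; exact: Nt.
Qed.

End nodal_count_bounds.

(** * Asymptotics of the nodal count *)

(** The dichotomy is that of the amplitude: [A = 0] makes [f] vanish, and for [A > 0] both counts of
    zeros apply. *)
Lemma edge_oscillation (R : realType) (l lam : R) (q f p : R -> R) : 0 < l -> 0 < lam ->
  L1 0 l q -> 16 * intg 0 l (fun x => `|q x|) <= Num.sqrt lam ->
  AC 0 l f p -> AC 0 l p (fun x => (q x - lam) * f x) ->
  let J := Num.truncn (Num.sqrt lam * l / pi) in
  (forall x, 0 <= x <= l -> f x = 0) \/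
  (exists2 Z : seq R, size Z = J.+4 & forall x, 0 <= x <= l -> f x = 0 -> x \in Z) /\
    alternates (J - 4) l f.
Proof.
move=> l0 lam0 q1 qm fp pf J; set m := Num.sqrt lam in qm J *.
have m0 : 0 < m by rewrite sqrtr_gt0.
have m2 : lam = m ^+ 2 by rewrite sqr_sqrtr// ltW.
rewrite m2 in pf; have [A [ph [A0 phpi cl]]] := sine_approximation l0 m0 q1 qm fp pf.
move: A0; rewrite le_eqVlt => /predU1P[A0|A0].
  left=> x xl; have [+ _] := cl x xl.
  by rewrite -A0 !mul0r subr0 normr_le0 => /eqP.
right; split; first exact: sine_close_zeros_le cl fp.
exact: sine_close_zeros_ge cl fp.
Qed.

Section nodal_asymptotics.
Context {R : realType} (G : metric_graph R).
Variables (q : edge G -> R -> R) (B : 'M[R[i]]_#|edge_end G|)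
  (w : edge_end G -> R) (V0 : {set vert G})
  (lam : nat -> R) (psi : nat -> edge G -> R -> R).
Hypotheses (q_L1 : forall e, L1 0 (len e) (q e)) (B_herm : B \is hermsymmx)
  (psi_basis : eigenbasis q B w V0 lam psi).

(** A test function supported on [e] and vanishing at both of its ends satisfies all vertex
    conditions and gives no boundary term, so that the weak equation decouples edge by edge. *)
Lemma eigenfunction_ode (u : gpair G) (la : R) (e : edge G) : form_domG w V0 u ->
  (forall v, form_domG w V0 v -> formG q (reB B) u v = la * dotG u v) ->
  exists p, AC 0 (len e) (u.1 e) p /\
    AC 0 (len e) p (fun x => (q e x - la) * u.1 e x).
Proof.
move=> [Hu _ _] eig; have [au lu] := Hu e; have cu := AC_cont au.
have qu : L1 0 (len e) (fun x => q e x * u.1 e x) by exact: L1_mul_cont.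
have lau : L1 0 (len e) (fun x => la * u.1 e x) by apply/L1Z/L1_cont.
have r1 : L1 0 (len e) (fun x => (q e x - la) * u.1 e x).
  by apply: L1_eq (L1B qu lau) => x _; ring.
have [|p [p1 p2 _]] := du_bois_reymond (len_gt0 e) au lu r1; last by exists p.
move=> h h' hh h2 h0 hl.
pose v : gpair G := (fun e' x => if e' == e then h x else 0,
                     fun e' x => if e' == e then h' x else 0).
have Hv : H1G v.
  move=> e'; rewrite /v /=; have [->//|ne] := eqVneq e' e.
  split; first exact: AC_cst.
  by apply: L2_cont; apply: continuous_within; exact: cst_continuous.
have zv i : end_val v.1 i = 0.
  case: i => e' s; rewrite /end_val /end_coord /v /=.
  by have [->|//] := eqVneq e' e; case: s.
have Wv : form_domG w V0 v by exact: form_domG_dirichlet.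
have loc (F : edge G -> R -> R) : (forall e' x, e' != e -> F e' x = 0) ->
    \sum_e' intg 0 (len e') (F e') = intg 0 (len e) (F e).
  move=> F0; rewrite (bigD1 e)//= big1 ?addr0// => e' ne.
  rewrite (@intg_eq _ _ _ _ (fun=> 0)); last by move=> x _; exact: F0.
  by rewrite intg_cst ?mul0r// ltW ?len_gt0.
have := eig v Wv; rewrite /formG.
have -> : boundaryG (reB B) u v = 0.
  by rewrite /boundaryG big1// => i _; rewrite big1// => j _; rewrite zv mulr0.
rewrite /energyG /potentialG /dotG /edge_sum !loc; first last.
- by move=> e' x /negbTE ne; rewrite /v /= ne mulr0.
- by move=> e' x /negbTE ne; rewrite /v /= ne mulr0.
- by move=> e' x /negbTE ne; rewrite /v /= ne mulr0.
rewrite addr0 => E.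
have e1 : intg 0 (len e) (fun x => u.2 e x * v.2 e x) =
  intg 0 (len e) (fun x => u.2 e x * h' x).
  by apply: intg_eq => x _; rewrite /v /= eqxx.
have e2 : intg 0 (len e) (fun x => q e x * u.1 e x * v.1 e x) =
  intg 0 (len e) (fun x => q e x * u.1 e x * h x).
  by apply: intg_eq => x _; rewrite /v /= eqxx.
have e3 : intg 0 (len e) (fun x => u.1 e x * v.1 e x) =
  intg 0 (len e) (fun x => u.1 e x * h x).
  by apply: intg_eq => x _; rewrite /v /= eqxx.
rewrite e1 e2 e3 in E.
have ch := AC_cont hh.
have uh : L1 0 (len e) (fun x => u.1 e x * h x) by apply: L1_mul_cont => //; exact: L1_cont.
have quh : L1 0 (len e) (fun x => q e x * u.1 e x * h x) by exact: L1_mul_cont.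
have -> : intg 0 (len e) (fun x => (q e x - la) * u.1 e x * h x) =
  intg 0 (len e) (fun x => q e x * u.1 e x * h x) - la * intg 0 (len e) (fun x => u.1 e x * h x).
  rewrite -intgZ// -intgB//; last exact: L1Z.
  by apply: intg_eq => x _; ring.
by rewrite addrA E subrr.
Qed.

(** [E0] consists of the edges on which [psi n] is not identically zero; it is nonempty because
    [psi n] has norm one. The constants do not depend on it, which is what allows it to change with
    [n]. *)
Lemma nodal_count_asymptotics : exists (C : R) (N : nat), forall n : nat, (N <= n)%N ->
  exists2 E0 : {set edge G}, E0 != finset.set0 &
    `|(nodal_count (psi n))%:R - n.+1%:R * ((\sum_(e in E0) len e) / total_len G)| <= C.
Proof.
have [Psi [PsiE PsiW Psi_eig Psi_orth Psi_compl]] := eigenpairs q_L1 psi_basis.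
have [_ _ lam_homo] := psi_basis.
have W_H1 u : form_domG w V0 u -> H1G u by case.
have W_sub := @form_domG_sub _ _ w V0.
have W_dir u := @form_domG_dirichlet _ _ w V0 u.
have tl := total_len_gt0 Psi_orth.
have [C [N HN]] := weyl_sqrt q_L1 (reB_sym B_herm) W_H1 W_sub W_dir PsiW Psi_eig
  Psi_orth lam_homo Psi_compl.
pose Q := \sum_(e : edge G) intg 0 (len e) (fun x => `|q e x|).
have Qe e : intg 0 (len e) (fun x => `|q e x|) <= Q.
  by rewrite /Q (bigD1 e)//= lerDl sumr_ge0// => e' _; exact: intg_ge0.
have p0 := pi_gt0 R.
have kap0 : 0 < pi / total_len G by rewrite divr_gt0.
(* Past this index Weyl's law gives a frequency of at least [16 * Q], as the sine approximation
   requires on every edge. *)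
pose thr := Num.truncn (`|(16 * Q + C) / (pi / total_len G)|).
pose nE := #|edge G|.
(* Per edge, [J + 4] zeros bound at most [J + 5] pieces, while [J - 4] and the rounding of [J] lose
   at most 5. The second term is the error of Weyl's law over a length of at most |G|. *)
exists (5 * nE%:R + C * total_len G / pi), (maxn N thr) => n.
rewrite geq_max => /andP[Nn thrn]; have [l0 lamn] := HN n Nn.
set m := Num.sqrt (lam n) in lamn.
have mQ : 16 * Q <= m.
  have /andP[_ h] := Num.Theory.truncn_itv (normr_ge0 ((16 * Q + C) / (pi / total_len G))).
  have h1 : (16 * Q + C) / (pi / total_len G) <= n.+1%:R.
    apply: (le_trans (ler_norm _)); apply: (le_trans (ltW h)).
    by rewrite ler_nat ltnS.
  move: h1; rewrite ler_pdivrMr// mulrC; move: lamn; rewrite ler_norml => /andP[+ _]; lra.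
have m0 : 0 < m by rewrite sqrtr_gt0.
pose J (e : edge G) := Num.truncn (m * len e / pi).
have osc e : (forall x, 0 <= x <= len e -> psi n e x = 0) \/
  (exists2 Z : seq R, size Z = (J e).+4 &
    forall x, 0 <= x <= len e -> psi n e x = 0 -> x \in Z) /\
    alternates (J e - 4) (len e) (psi n e).
  have [p [fp pf]] := eigenfunction_ode e (PsiW n) (Psi_eig n).
  rewrite PsiE in fp pf; apply: edge_oscillation fp pf => //; first exact: len_gt0.
  by apply: le_trans mQ; rewrite ler_pM2l.
pose vanishes (e : edge G) := `[< forall x, 0 <= x <= len e -> psi n e x = 0 >].
pose E0 : {set edge G} := [set e | ~~ vanishes e]%SET.
have inE0 e : e \in E0 = ~~ vanishes e by rewrite finset.inE.
exists E0.
  apply/negP => /eqP E00; have := Psi_orth n n; rewrite eqxx /dotG /edge_sum big1.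
    by move/esym/eqP; rewrite oner_eq0.
  move=> e _; have : e \notin E0 by rewrite E00 finset.inE.
  rewrite inE0 negbK => /asboolP fz.
  rewrite (@intg_eq _ _ _ _ (fun=> 0)) ?intg_cst ?mul0r//; first by rewrite ltW ?len_gt0.
  by move=> x xl; rewrite PsiE fz// mul0r.
have Zex e : exists Z : seq R, e \in E0 -> size Z = (J e).+4 /\
    forall x, 0 <= x <= len e -> psi n e x = 0 -> x \in Z.
  have [fz|[[Z sZ HZ] _]] := osc e; last by exists Z.
  by exists [::]; rewrite inE0 => /negP[]; apply/asboolP.
have /choice[Z HZ] := Zex.
have vanish e x : e \notin E0 -> 0 <= x <= len e -> psi n e x = 0.
  by rewrite inE0 negbK => /asboolP; apply.
have zeros e x : e \in E0 -> 0 <= x <= len e -> psi n e x = 0 -> x \in Z e.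
  by move=> /HZ[_]; apply.
have [fin le] := nodal_count_le vanish zeros.
pose al (e : edge G) := if e \in E0 then (J e - 4)%N else 0%N.
have alt e : alternates (al e) (len e) (psi n e).
  rewrite /al; case: ifPn => eE; last by exists (fun=> 0), (fun=> 0) => j; rewrite ltn0.
  have [fz|[_ //]] := osc e.
  by move: eE; rewrite inE0 => /negP[]; apply/asboolP.
have ge := nodal_count_ge fin alt.
set nu := nodal_count (psi n) in le ge *.
pose LE := \sum_(e in E0) len e.
have Jb e : (J e)%:R <= m * len e / pi < (J e)%:R + 1.
  rewrite natr1; apply: Num.Theory.truncn_itv.
  by rewrite divr_ge0 ?mulr_ge0// ltW// len_gt0.
have mLE : \sum_(e in E0) m * len e / pi = m / pi * LE.
  by rewrite /LE mulr_sumr; apply: eq_bigr => e _; ring.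
have cE0 : \sum_(e in E0) (5 : R) <= 5 * nE%:R.
  by rewrite sumr_const -[leLHS]mulr_natr ler_pM2l// ler_nat max_card.
have up : nu%:R <= m / pi * LE + 5 * nE%:R.
  apply: le_trans (lerD (lexx (m / pi * LE)) cE0).
  rewrite -mLE -big_split/=.
  apply: (@le_trans _ _ ((\sum_(e in E0) (size (Z e)).+1)%N%:R)); first by rewrite ler_nat.
  rewrite natr_sum; apply: ler_sum => e eE; have [-> _] := HZ e eE.
  have /andP[h _] := Jb e; have -> : (J e).+4.+1%:R = (J e)%:R + 5 :> R.
    by rewrite -(natrD R (J e) 5) !addnS addn0.
  by rewrite lerD2r.
have lo : m / pi * LE - 5 * nE%:R <= nu%:R.
  apply: (@le_trans _ _ (m / pi * LE - \sum_(e in E0) (5 : R))); first by rewrite lerB.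
  apply: (@le_trans _ _ ((\sum_e al e)%N%:R)); last by rewrite ler_nat.
  have -> : (\sum_e al e = \sum_(e in E0) (J e - 4))%N by rewrite [RHS]big_mkcond.
  rewrite -mLE -sumrB natr_sum; apply: ler_sum => e eE.
  have /andP[_ h] := Jb e.
  have : (J e)%:R <= (J e - 4)%N%:R + 4 :> R by rewrite -natrD ler_nat addnC -leq_subLR.
  move: h; lra.
have LE0 : 0 <= LE by apply: sumr_ge0 => e _; rewrite ltW ?len_gt0.
have LEtl : LE <= total_len G.
  rewrite /LE /total_len big_mkcond; apply: ler_sum => e _.
  by case: ifP => // _; rewrite ltW ?len_gt0.
have C_ge0 : 0 <= C by apply: le_trans lamn.
have E1 : `|m / pi * LE - n.+1%:R * (LE / total_len G)| <= C * total_len G / pi.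
  have -> : m / pi * LE - n.+1%:R * (LE / total_len G) =
    (m - pi / total_len G * n.+1%:R) * (LE / pi).
    have key (P T : R) : P != 0 -> T != 0 ->
        m / P * LE - n.+1%:R * (LE / T) = (m - P / T * n.+1%:R) * (LE / P).
      by move=> P0 T0; field; rewrite P0 T0.
    by apply: key; rewrite gt_eqF.
  rewrite normrM (@ger0_norm _ (LE / pi)); last by rewrite divr_ge0// ltW.
  rewrite -[leRHS]mulrA ler_pM//; first by rewrite divr_ge0// ltW.
  by rewrite ler_pM2r ?invr_gt0.
rewrite -/LE; move: E1; rewrite !ler_norml => /andP[h1 h2].
by apply/andP; split; move: up lo h1 h2; lra.
Qed.

End nodal_asymptotics.

(** * Bounds on lower and upper limits *)

Section limits.
Context {R : realType}.
Implicit Types (u : nat -> \bar R) (c : \bar R).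

Lemma le_limn_einf u c (N : nat) : (forall n : nat, (N <= n)%N -> (c <= u n)%E) ->
  (c <= limn_einf u)%E.
Proof.
move=> H; rewrite limn_einf_lim; apply: lime_ge; first exact: is_cvg_einfs.
near=> m; apply: le_ereal_inf_tmp => _ [n /= mn <-]; apply: H.
by apply: leq_trans mn; near: m; exists N.
Unshelve. all: by end_near. Qed.

Lemma limn_esup_le u c (N : nat) : (forall n : nat, (N <= n)%N -> (u n <= c)%E) ->
  (limn_esup u <= c)%E.
Proof.
move=> H; rewrite limn_esup_lim; apply: lime_le; first exact: is_cvg_esups.
near=> m; apply: ge_ereal_sup => _ [n /= mn <-]; apply: H.
by apply: leq_trans mn; near: m; exists N.
Unshelve. all: by end_near. Qed.

Lemma increasing_ge_id (phi : nat -> nat) : {homo phi : m n / (m < n)%N} ->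
  forall n, (n <= phi n)%N.
Proof. by move=> mono; elim=> // n IH; apply: (leq_ltn_trans IH); exact: mono. Qed.

End limits.

Theorem theorem3p3 (R : realType) (G : metric_graph R)
    (q : edge G -> R -> R) (B : 'M[R[i]]_#|edge_end G|)
    (w : edge_end G -> R) (V0 : {set vert G})
    (lam : nat -> R) (psi : nat -> edge G -> R -> R)
    (q_int : forall e, (@lebesgue_measure R).-integrable `[0, len e]
       (fun x => (q e x)%:E))
    (q_ge0 : forall e, {ae @lebesgue_measure R, forall x : R,
       0 <= x <= len e -> 0 <= q e x})
    (B_herm : B \is hermsymmx)
    (B_pos : generates_positive_semigroup B)
    (w_gt0 : forall i : edge_end G, vert_of i \notin V0 -> 0 < w i)
    (psi_basis : eigenbasis q B w V0 lam psi) :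
  [/\ acc (nodal_ratio psi) `<=`
        [set r | exists2 E0 : {set edge G}, E0 != finset.set0
                 & r = (\sum_(e in E0) len e) / total_len G],
      finite_set (acc (nodal_ratio psi)) &
      [/\ 0 < min_len G / total_len G,
          ((min_len G / total_len G)%:E <=
             limn_einf (fun n => (nodal_ratio psi n)%:E))%E,
          (limn_einf (fun n => (nodal_ratio psi n)%:E) <=
             limn_esup (fun n => (nodal_ratio psi n)%:E))%E &
          (limn_esup (fun n => (nodal_ratio psi n)%:E) <= 1)%E]].
Proof.
have [C [N HN]] := nodal_count_asymptotics q_int B_herm psi_basis.
pose frac (E0 : {set edge G}) : R := (\sum_(e in E0) len e) / total_len G.
pose a := nodal_ratio psi.
(* [harmonic n] is 1 / (n + 1), by which the bounded error of the count is divided. Below [N]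
   nothing is claimed and the empty set is a default. *)
have /choice[E HE] : forall n, exists E0 : {set edge G}, (N <= n)%N ->
    E0 != finset.set0 /\ `|a n - frac E0| <= C * harmonic n.
  move=> n; have [/HN[E0 E0n Hn]|nN] := leqP N n; last first.
    by exists finset.set0.
  exists E0 => _; split=> //; rewrite /a /nodal_ratio /harmonic /=.
  have n0 : 0 < n.+1%:R :> R by rewrite ltr0n.
  have -> : (nodal_count (psi n))%:R / n.+1%:R - frac E0 =
      ((nodal_count (psi n))%:R - n.+1%:R * frac E0) / n.+1%:R.
    by field; rewrite gt_eqF.
  rewrite normrM (@ger0_norm _ n.+1%:R^-1) ?invr_ge0 ?(ltW n0)//.
  by rewrite ler_pM2r ?invr_gt0.
set S := [set r | _].
have Sfin : finite_set S.
  apply: (@sub_finite_set _ _ [set frac E0 | E0 in [set: {set edge G}]]).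
    by move=> r [E0 _ ->]; exists E0.
  exact/finite_image/finite_finset.
have E_S n : (N <= n)%N -> S (frac (E n)) by move=> /HE[? _]; exists (E n).
have accS : acc a `<=` S.
  move=> l [phi [mono cvl]].
  have phin := increasing_ge_id mono.
  have d0 : (a \o phi \- (fun n => frac (E (phi n)))) @ \oo --> (0 : R).
    apply: (@squeeze_cvgr _ _ _ _ (fun n => - (C * harmonic n)) (fun n => C * harmonic n)).
    - near=> n; have Nn : (N <= phi n)%N.
        by apply: leq_trans (phin n); near: n; exists N.
      have [_ h] := HE _ Nn; rewrite -ler_norml; apply: (le_trans h).
      rewrite ler_wpM2l//.
        have [_ h0] := HE N (leqnn N); have := le_trans (normr_ge0 _) h0.
        by rewrite pmulr_lge0// /harmonic/= invr_gt0 ltr0n.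
      by rewrite /harmonic /= lef_pV2 ?posrE ?ltr0n// ler_nat ltnS.
    - rewrite -oppr0 -[X in - X](mulr0 C); apply: cvgN.
      by apply: cvgM; [exact: cvg_cst|exact: cvg_harmonic].
    - rewrite -[X in _ --> X](mulr0 C); apply: cvgM; [exact: cvg_cst|exact: cvg_harmonic].
  have cvE : (fun n => frac (E (phi n))) @ \oo --> l.
    rewrite -[X in _ --> X]subr0 (_ : (fun n => _) =
      (a \o phi) \- ((a \o phi) \- (fun n => frac (E (phi n))))).
      exact: cvgB.
    by apply/funext => n /=; rewrite opprB addrC subrK.
  (* Being finite, [S] is closed, and so contains the limit of the fractions [frac (E (phi n))]. *)
  have cS : closed S.
    by apply: (proj1 accessible_finite_set_closed (hausdorff_accessible (@Rhausdorff R))).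
  apply: (closed_cvg _ cS) cvE; near=> n; apply: E_S.
  by apply: leq_trans (phin n); near: n; exists N.
have tl : 0 < total_len G.
  have [/finset.set0Pn[e _] _] := HE N (leqnn N).
  by rewrite /total_len (bigD1 e)//= ltr_wpDr ?len_gt0// sumr_ge0// => *; rewrite ltW ?len_gt0.
have frac_le1 E0 : frac E0 <= 1.
  rewrite /frac ler_pdivrMr// mul1r /total_len big_mkcond; apply: ler_sum => e _.
  by case: ifP => // _; rewrite ltW ?len_gt0.
have frac_ge E0 : E0 != finset.set0 -> min_len G / total_len G <= frac E0.
  move=> /finset.set0Pn[e eE]; rewrite /frac ler_pM2r ?invr_gt0//.
  rewrite (bigD1 e)//=; apply: (@le_trans _ _ (len e)); first exact: bigmin_le.
  by rewrite lerDl sumr_ge0// => *; rewrite ltW ?len_gt0.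
have C0 : 0 <= C.
  have [_ h0] := HE N (leqnn N); have := le_trans (normr_ge0 _) h0.
  by rewrite pmulr_lge0// /harmonic/= invr_gt0 ltr0n.
have small (eps : R) : 0 < eps -> exists M : nat, forall n : nat, (M <= n)%N ->
    E n != finset.set0 /\ `|a n - frac (E n)| <= eps.
  move=> e0; exists (maxn N (Num.truncn (C / eps))) => n.
  rewrite geq_max => /andP[Nn Mn]; have [En h] := HE n Nn; split=> //.
  apply: (le_trans h); rewrite /harmonic/= ler_pdivrMr ?ltr0n// mulrC -ler_pdivrMr//.
  have /andP[_ /ltW h1] := Num.Theory.truncn_itv (divr_ge0 C0 (ltW e0)).
  by apply: (le_trans h1); rewrite ler_nat.
split=> //; first exact: sub_finite_set accS Sfin.
split.
- rewrite divr_gt0//; apply/bigmin_gtP; split=> // e _; exact: len_gt0.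
(* The ratio is eventually within [eps] of a fraction, and a nonempty set of edges has at least the
   shortest length. *)
- apply/lee_addgt0Pr => eps e0; have [M HM] := small eps e0.
  rewrite -leeBlDr//; apply: (@le_limn_einf _ _ _ M) => n /HM[En].
  rewrite -EFinB lee_fin ler_norml => /andP[+ _]; have := frac_ge _ En.
  by rewrite -/(a n); lra.
- exact: limn_einf_sup.
- apply/lee_addgt0Pr => eps e0; have [M HM] := small eps e0.
  apply: (@limn_esup_le _ _ _ M) => n /HM[En].
  rewrite -EFinD lee_fin ler_norml => /andP[_]; have := frac_le1 (E n).
  by rewrite -/(a n); lra.
Unshelve. all: by end_near.
Qed.
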